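(* Let $\gamma>1$ and let $\{(\rho^\mu,\mathbf u^\mu)\}_{\mu}$ be a family, indexed by the viscosity coefficient $\mu>0$, of periodic weak solutions of the Cauchy problem for the compressible barotropic Navier-Stokes equations with common initial data $(\rho_0,\mathbf u_0)$ and force $\mathbf f$, in the sense of the context. Assume that the family satisfies Assumption (CKHw) stated in the context. Then for any $T\in(0,\infty)$ and any $\alpha\in(0,\tfrac{\beta}{2})$, where $\beta>0$ is the exponent in Assumption (CKHw), there exists $M_T>0$, independent of $\mu>0$, such that $$\big\|(\sqrt{\rho^\mu}\,\mathbf u^\mu,\ \sqrt{\rho^\mu}\,c(\rho^\mu))\big\|_{L^2(0,T;H^\alpha(\mathbb T_P))}\le M_T<\infty .$$
   Context: Period cell: $\mathbb T_P=[-\frac P2,\frac P2]^3\subset\mathbb R^3$, $P>0$; all functions of $\mathbf x\in\mathbb R^3$ are $P$-periodic in each coordinate direction (periodic with period $\mathbb T_P$). Equations: $\partial_t\rho+\nabla\cdot(\rho\mathbf u)=0$, $\ \partial_t(\rho\mathbf u)+\nabla\cdot(\rho\mathbf u\otimes\mathbf u)+\nabla p=\nabla\cdot\Sigma+\rho\mathbf f$, with Cauchy data $(\rho,\mathbf u)|_{t=0}=(\rho_0,\mathbf u_0)$, where $\Sigma=\Sigma(\nabla\mathbf u)=\mu(\nabla\mathbf u+(\nabla\mathbf u)^\top)+\lambda(\nabla\cdot\mathbf u)\mathbf I_{3\times3}$, $\mu>0$, $\max\{\mu,|\lambda|\}\in(0,\mu_0)$ for a fixed $\mu_0>0$, $\lambda+\frac23\mu\ge0$,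 and $\lambda=\lambda(\mu)\to0$ as $\mu\to0$. Pressure: $p=p(\rho)=\kappa\rho^\gamma$ with $\kappa>0$, $\gamma>1$. Sonic speed $c=c(\rho)\ge0$, normalized by $\frac{p}{(\gamma-1)\rho}=\frac{c^2}{\gamma-1}$, so $\sqrt\rho\,c(\rho)=\sqrt\kappa\,\rho^{\gamma/2}$. Total energy: $E=\frac12|\sqrt\rho\,\mathbf u|^2+\frac1{\gamma-1}(\sqrt\rho\,c)^2$. Momentum: $\mathbf m=\rho\mathbf u$. Standing assumptions on the data: $\mathbf f\in L^1_{\rm loc}(\mathbb R_+;L^{\frac{2\gamma}{\gamma-1}}(\mathbb T_P))$ is periodic; $(\rho_0,\mathbf u_0)$ is periodic, $\rho_0\not=0$, $\rho_0\ge0$ a.e. in $\mathbb T_P$, $\mathbf m_0=\rho_0\mathbf u_0\in L^{\frac{2\gamma}{\gamma+1}}(\mathbb T_P)$, and $\mathcal E_0=\int_{\mathbb T_P}\big(\frac12\rho_0|\mathbf u_0|^2+\frac{p(\rho_0)}{\gamma-1}\big)d\mathbf x<\infty$. The data $(\rho_0,\mathbf u_0)$ and $\mathbf f$ do not depend on $\mu$. Weak solution of the Navier-Stokes equations: a periodic $(\rho^\mu,\mathbf u^\mu)(t,\mathbf x)$ such that (i) for any $T>0$ the equations hold in the sense of distributions in $[0,T)\times\mathbb R^3$ with the initial condition, and $\mathbf u^\mu\in L^2(0,T;H^1(\mathbb T_P))$, $\nabla\mathbf u^\mu\in L^2([0,T)\times\mathbb T_P)$, $\rho^\mu\in C([0,T];L^\gamma_{\rm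 w}(\mathbb T_P))\cap L^p([0,T)\times\mathbb T_P)$ for $1\le p\le\max\{\frac{5\gamma-3}3,1\}$, $\mathbf m^\mu=\rho^\mu\mathbf u^\mu\in C([0,T];L^{\frac{2\gamma}{\gamma+1}}_{\rm w}(\mathbb T_P))$, $\rho^\mu|\mathbf u^\mu|^2\in L^\infty(0,T;L^1(\mathbb T_P))$, where $\mathbf v\in C([0,T];L^q_{\rm w})$ means $\mathbf v\in L^\infty(0,T;L^q)$ and $\mathbf v$ is continuous in $t$ for the weak topology of $L^q$; (ii) in the sense of distributions in $[0,T)\times\mathbb R^3$ (so with initial energy included), $$\partial_tE^\mu+\nabla\cdot((E^\mu+p^\mu)\mathbf u^\mu)+\mu|\nabla\mathbf u^\mu|^2+(\lambda+\mu)|\nabla\cdot\mathbf u^\mu|^2\le\nabla\cdot(\Sigma(\nabla\mathbf u^\mu)\mathbf u^\mu)+\mathbf m^\mu\cdot\mathbf f .$$ Such solutions are assumed to exist for the values of $\mu$ considered. Fourier coefficients: for $\mathbf k\in\frac{2\pi}P\mathbb Z^3$, $(\widehat{\sqrt\rho\,\mathbf u},\widehat{\sqrt\rho\,c(\rho)})(t,\mathbf k)=\frac1{|\mathbb T_P|}\int_{\mathbb T_P}(\sqrt\rho\,\mathbf u,\sqrt\rho\,c(\rho))(t,\mathbf x)e^{-i\mathbf k\cdot\mathbf x}d\mathbf x$. Assumption (CKHw): for any $T>0$ there exist $C_T>0$, $k_*$ (sufficiently large) and $\beta>0$, all independent of $\mu$, such that $$|\mathbf k|^{3+\beta}\int_0^T\big|(\widehat{\sqrt{\rho^\mu}\,\mathbf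 u^\mu},\widehat{\sqrt{\rho^\mu}\,c(\rho^\mu)})(t,\mathbf k)\big|^2dt\le C_T\qquad\text{for all }\mathbf k\text{ with }|\mathbf k|\ge k_* .$$ $H^\alpha(\mathbb T_P)$ is the periodic Sobolev space defined via Fourier coefficients. The constant $M_T$ may depend on $T,\gamma,\mathcal E_0,\|\mathbf f\|_{L^1(0,T;L^{2\gamma/(\gamma-1)}(\mathbb T_P))}$, the constants in (CKHw) and $\alpha$, but not on $\mu$. *)

(* Defs.v *)
(** Built on MathComp-Analysis.

    A space point is a triple [x : R * R * R], a space-time point is a pair
    [(t, x)]; vectors are row vectors ['rV[R]_n].  Real powers are [powR];
    integrals, L^p norms and Bochner norms are Lebesgue ones, computed on Borel
    representatives defined everywhere. *)
From HB Require Import structures.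
From mathcomp Require Import all_boot all_order all_algebra.
From mathcomp Require Import all_classical all_reals all_analysis.
From mathcomp Require Import complex.

Set Implicit Arguments.
Unset Strict Implicit.
Unset Printing Implicit Defensive.
Import Order.TTheory GRing.Theory Num.Theory numFieldNormedType.Exports.
Local Open Scope classical_set_scope.
Local Open Scope ring_scope.

Notation E3 R := (R * R * R)%type.

(** The library's sigma-finite instance for [\x] is not inferred outside
    subprobabilities, hence the explicit instances below. *)
Lemma sigma_finite_prod d1 d2 (T1 : measurableType d1) (T2 : measurableType d2)
    (R : realType) (m1 : {sigma_finite_measure set T1 -> \bar R})
    (m2 : {sigma_finite_measure set T2 -> \bar R}) :
  sigma_finite setT (m1 \x m2)%E.
Proof.
have /sigma_finiteP[F [TF ndF Foo]] := sigma_finiteT m1.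
have /sigma_finiteP[G [TG ndG Goo]] := sigma_finiteT m2.
exists (fun n => F n `*` G n).
  rewrite -setXTT TF TG predeqE => -[x y]; split.
    move=> [/= [n _ Fnx] [k _ Gky]]; exists (maxn n k) => //; split.
    - by move: x Fnx; exact/subsetPset/ndF/leq_maxl.
    - by move: y Gky; exact/subsetPset/ndG/leq_maxr.
  by move=> [n _ []/= ? ?]; split; exists n.
move=> k; have [? ?] := Foo k; have [? ?] := Goo k.
split; first exact: measurableX.
by rewrite product_measure1E// lte_mul_pinfty// ge0_fin_numE.
Qed.

Section measures.
Variable R : realType.
Let B := measurableTypeR R.

Definition leb : {sigma_finite_measure set B -> \bar R} := lebesgue_measure.

Definition leb2 : set (B * B)%type -> \bar R := (leb \x leb)%E.
HB.instance Definition _ := Measure.on leb2.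
HB.instance Definition _ :=
  Measure_isSigmaFinite.Build _ _ _ leb2 (sigma_finite_prod leb leb).

Definition vol : set (B * B * B)%type -> \bar R := (leb2 \x leb)%E.
HB.instance Definition _ := Measure.on vol.
HB.instance Definition _ :=
  Measure_isSigmaFinite.Build _ _ _ vol (sigma_finite_prod leb2 leb).

Definition stvol : set (B * (B * B * B))%type -> \bar R := (leb \x vol)%E.
HB.instance Definition _ := Measure.on stvol.
HB.instance Definition _ :=
  Measure_isSigmaFinite.Build _ _ _ stvol (sigma_finite_prod leb vol).

End measures.
Arguments leb {R}.
Arguments vol {R}.
Arguments stvol {R}.

Section euclidean.
Variable R : realType.

Definition xcoord (x : E3 R) (j : 'I_3) : R :=
  nth 0 [:: x.1.1; x.1.2; x.2] j.

Definition unit_dir (j : 'I_3) : E3 R :=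
  ((j == 0 :> nat)%:R, (j == 1 :> nat)%:R, (j == 2 :> nat)%:R).

Definition vdot n (v w : 'rV[R]_n) : R := \sum_(i < n) v 0 i * w 0 i.

Definition vnorm n (v : 'rV[R]_n) : R := Num.sqrt (vdot v v).

Definition mxnorm (A : 'M[R]_3) : R :=
  Num.sqrt (\sum_(i < 3) \sum_(j < 3) A i j ^+ 2).

Definition cell (P : R) : set (E3 R) :=
  [set x | forall j : 'I_3, - (P / 2) <= xcoord x j <= P / 2].

Definition periodic (P : R) (A : Type) (g : E3 R -> A) : Prop :=
  forall (x : E3 R) (j : 'I_3), g (x + P *: unit_dir j) = g x.

Definition forward : set (R * E3 R) := [set z | 0 <= z.1].

Definition stcell (P T : R) : set (R * E3 R) := `[0, T]%classic `*` cell P.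

End euclidean.
Arguments forward {R}.

Section norms.
Variable R : realType.
Local Open Scope ereal_scope.

Definition Lx_norm (P : R) (q : \bar R) (g : E3 R -> R) : \bar R :=
  'N[vol]_q[patch (cst 0) (cell P) (EFin \o g)].

Definition Ltx_norm (P T : R) (p : \bar R) (g : R -> E3 R -> R) : \bar R :=
  'N[stvol]_p[patch (cst 0) (stcell P T) (EFin \o uncurry g)].

(** The norm of [L^r(0,T;L^q(T_P))]. *)
Definition LtLx_norm (P T : R) (r q : \bar R) (g : R -> E3 R -> R) :
    \bar R :=
  'N[leb]_r[patch (cst 0) `[0%R, T]%classic (fun t => Lx_norm P q (g t))].

End norms.

Section fourier.
Variable R : realType.

Definition freq (P : R) (k : 'rV[int]_3) : 'rV[R]_3 :=
  \row_j (2 * pi / P * (k 0 j)%:~R).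

Definition phase (P : R) (k : 'rV[int]_3) (x : E3 R) : R :=
  \sum_(j < 3) freq P k 0 j * xcoord x j.

(** The coefficient at the frequency [freq P k], using
    [exp (- i s) = cos s - i sin s]. *)
Definition fourier (P : R) (g : E3 R -> R) (k : 'rV[int]_3) : R[i] :=
  let cellvol := fine (vol (cell P)) in
  ((cellvol^-1 * \int[vol]_(x in cell P) (g x * cos (phase P k x))) +i*
   (- (cellvol^-1 * \int[vol]_(x in cell P) (g x * sin (phase P k x)))))%C.

(** Squared modulus of the vector of the coefficients of the components. *)
Definition fourier_sq (P : R) n (g : E3 R -> 'rV[R]_n) (k : 'rV[int]_3) :
    R :=
  \sum_(i < n) Normc.normc (fourier P (fun x => g x 0 i) k) ^+ 2.

Definition sobolev_norm (P alpha : R) n (g : E3 R -> 'rV[R]_n) : \bar R :=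
  ((\esum_(k in [set: 'rV[int]_3])
      ((1 + vnorm (freq P k) ^+ 2) `^ alpha * fourier_sq P g k)%:E)
   `^ 2^-1)%E.

(** The norm of [L^2(0,T;H^alpha(T_P))]. *)
Definition L2H_norm (P T alpha : R) n (g : R -> E3 R -> 'rV[R]_n) :
    \bar R :=
  ('N[leb]_(2%:E)[patch (cst 0) `[0%R, T]%classic
     (fun t => sobolev_norm P alpha (g t))])%E.

End fourier.

Section weak_formulation.
Variable R : realType.

(** [f] is of class C^n: all directional derivatives up to order [n] exist and
    are continuous. *)
Fixpoint Ck (V : normedModType R) (n : nat) (f : V -> R) : Prop :=
  continuous f /\
  if n is m.+1 then
    forall v : V, (forall x, derivable f x v) /\ Ck m ('D_v f)
  else True.

(** Restrictions to [t >= 0] of these functions are the test functions on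
    [[0, T[ x R^3]; they need not vanish at [t = 0]. *)
Definition test_function (T : R) (phi : R * E3 R -> R) : Prop :=
  (forall n, Ck n phi) /\
  exists K : set (R * E3 R),
    [/\ compact K, K `<=` [set z | z.1 < T] & forall z, ~ K z -> phi z = 0].

Definition dt (phi : R * E3 R -> R) : R * E3 R -> R :=
  'D_((1, 0) : R * E3 R) phi.

Definition dx (j : 'I_3) (phi : R * E3 R -> R) : R * E3 R -> R :=
  'D_((0, unit_dir R j) : R * E3 R) phi.

Definition st_loc_integrable (g : R -> E3 R -> R) : Prop :=
  forall K : set (R * E3 R), compact K -> K `<=` forward ->
    stvol.-integrable K (EFin \o uncurry g).

Definition loc_integrable (g : E3 R -> R) : Prop :=
  forall K : set (E3 R), compact K -> vol.-integrable K (EFin \o g).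

(** The action on [phi] of [s - (d_t a + div F)], with [a = a0] at [t = 0]. *)
Definition weak_action (a : R -> E3 R -> R) (F : R -> E3 R -> 'rV[R]_3)
    (s : R -> E3 R -> R) (a0 : E3 R -> R) (phi : R * E3 R -> R) : R :=
  \int[stvol]_(z in forward)
    (a z.1 z.2 * dt phi z + \sum_(j < 3) F z.1 z.2 0 j * dx j phi z
     + s z.1 z.2 * phi z)
  + \int[vol]_x (a0 x * phi (0, x)).

Definition all_loc_integrable (a : R -> E3 R -> R)
    (F : R -> E3 R -> 'rV[R]_3) (s : R -> E3 R -> R)
    (a0 : E3 R -> R) : Prop :=
  [/\ st_loc_integrable a,
      forall j, st_loc_integrable (fun t x => F t x 0 j),
      st_loc_integrable s & loc_integrable a0].

(** [d_t a + div F = s] in the sense of distributions on [[0, T[ x R^3], with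
    initial value [a0]. *)
Definition balance_eq (T : R) (a : R -> E3 R -> R)
    (F : R -> E3 R -> 'rV[R]_3) (s : R -> E3 R -> R)
    (a0 : E3 R -> R) : Prop :=
  all_loc_integrable a F s a0 /\
  forall phi, test_function T phi -> weak_action a F s a0 phi = 0.

(** [d_t a + div F <= s] in the same sense. *)
Definition balance_le (T : R) (a : R -> E3 R -> R)
    (F : R -> E3 R -> 'rV[R]_3) (s : R -> E3 R -> R)
    (a0 : E3 R -> R) : Prop :=
  all_loc_integrable a F s a0 /\
  forall phi, test_function T phi -> (forall z, 0 <= z.1 -> 0 <= phi z) ->
    0 <= weak_action a F s a0 phi.

(** [v \in C([0,T]; L^q_w(T_P))] for the class of [v] up to null sets: [w] is
    its weakly continuous representative. *)
Definition weakly_continuous (P T q : R) (v : R -> E3 R -> R) : Prop :=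
  (LtLx_norm P T +oo%E q%:E v < +oo)%E /\
  exists w : R -> E3 R -> R,
    [/\ {ae stvol, forall z, stcell P T z -> w z.1 z.2 = v z.1 z.2},
        forall t : R, 0 <= t <= T ->
          measurable_fun (cell P) (w t) /\
          (Lx_norm P q%:E (w t) < +oo)%E
      & forall psi : E3 R -> R,
          measurable_fun (cell P) psi ->
          (Lx_norm P (q / (q - 1))%:E psi < +oo)%E ->
          {within `[0, T],
            continuous (fun t : R => \int[vol]_(x in cell P) (w t x * psi x))}].

End weak_formulation.

Section navier_stokes.
Variable R : realType.
Variables P kappa gamma : R.

Definition pressure (rho : R) : R := kappa * rho `^ gamma.

(** [p / ((gamma - 1) rho) = c^2 / (gamma - 1)]; [c = 0] in vacuum. *)
Definition sound (rho : R) : R := Num.sqrt (pressure rho / rho).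

Definition energy (rho : R) (u : 'rV[R]_3) : R :=
  2^-1 * vnorm (Num.sqrt rho *: u) ^+ 2
  + (gamma - 1)^-1 * (Num.sqrt rho * sound rho) ^+ 2.

(** [(sqrt rho u, sqrt rho c(rho))]. *)
Definition state (rho : R) (u : 'rV[R]_3) : 'rV[R]_(3 + 1) :=
  row_mx (Num.sqrt rho *: u) (Num.sqrt rho * sound rho)%:M.

(** [A] stands for the velocity gradient, [A i j = d_j u_i]. *)
Definition stress (mu lambda : R) (A : 'M[R]_3) : 'M[R]_3 :=
  mu *: (A + A^T) + (lambda * \tr A)%:M.

Definition initial_energy (rho0 : E3 R -> R) (u0 : E3 R -> 'rV[R]_3) :
    \bar R :=
  (\int[vol]_(x in cell P)
     (2^-1 * rho0 x * vnorm (u0 x) ^+ 2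
      + pressure (rho0 x) / (gamma - 1))%:E)%E.

Definition force_norm (T : R) (f : R -> E3 R -> 'rV[R]_3) : \bar R :=
  LtLx_norm P T 1%:E (2 * gamma / (gamma - 1))%:E (fun t x => vnorm (f t x)).

Definition admissible_data (rho0 : E3 R -> R) (u0 : E3 R -> 'rV[R]_3)
    (f : R -> E3 R -> 'rV[R]_3) : Prop :=
  [/\ [/\ forall t : R, 0 <= t -> periodic P (f t),
          forall i, measurable_fun forward (uncurry (fun t x => f t x 0 i))
        & forall T : R, 0 < T -> (force_norm T f < +oo)%E],
      [/\ periodic P rho0, periodic P u0, measurable_fun setT rho0
        & forall i, measurable_fun setT (fun x => u0 x 0 i)],
      ~ {ae vol, forall x, cell P x -> rho0 x = 0}
      /\ {ae vol, forall x, cell P x -> 0 <= rho0 x},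
      (Lx_norm P (2 * gamma / (gamma + 1))%:E
         (fun x => vnorm (rho0 x *: u0 x)) < +oo)%E
    & (initial_energy rho0 u0 < +oo)%E].

Definition admissible_viscosity (mu0 mu lambda : R) : Prop :=
  [/\ 0 < mu, Num.max mu `|lambda| < mu0 & 0 <= lambda + 2 / 3 * mu].

(** [Du] is the gradient of [u] in the sense of distributions on
    [[0, T[ x R^3]. *)
Definition weak_gradient (T : R) (u : R -> E3 R -> 'rV[R]_3)
    (Du : R -> E3 R -> 'M[R]_3) : Prop :=
  forall i j : 'I_3,
    balance_eq T (fun _ _ => 0) (fun t x => u t x 0 i *: delta_mx 0 j)
      (fun t x => Du t x i j) (fun _ => 0).

Definition regularity (T : R) (rho : R -> E3 R -> R)
    (u : R -> E3 R -> 'rV[R]_3) (Du : R -> E3 R -> 'M[R]_3) : Prop :=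
  [/\ (LtLx_norm P T 2%:E 2%:E (fun t x => vnorm (u t x)) < +oo)%E
      /\ (L2H_norm P T 1 u < +oo)%E,
      (Ltx_norm P T 2%:E (fun t x => mxnorm (Du t x)) < +oo)%E,
      weakly_continuous P T gamma rho
      /\ (forall p : R, 1 <= p <= Num.max ((5 * gamma - 3) / 3) 1 ->
            (Ltx_norm P T p%:E rho < +oo)%E),
      forall i, weakly_continuous P T (2 * gamma / (gamma + 1))
                  (fun t x => (rho t x *: u t x) 0 i)
    & (LtLx_norm P T +oo%E 1%:E (fun t x => (rho t x * vnorm (u t x) ^+ 2)%R)
         < +oo)%E].

Definition mass_equation (T : R) (rho0 : E3 R -> R)
    (rho : R -> E3 R -> R) (u : R -> E3 R -> 'rV[R]_3) : Prop :=
  balance_eq T rho (fun t x => rho t x *: u t x) (fun _ _ => 0) rho0.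

Definition momentum_equation (T mu lambda : R) (rho0 : E3 R -> R)
    (u0 : E3 R -> 'rV[R]_3) (f : R -> E3 R -> 'rV[R]_3)
    (rho : R -> E3 R -> R) (u : R -> E3 R -> 'rV[R]_3)
    (Du : R -> E3 R -> 'M[R]_3) : Prop :=
  forall i : 'I_3,
    balance_eq T (fun t x => rho t x * u t x 0 i)
      (fun t x => (rho t x * u t x 0 i) *: u t x
                  + pressure (rho t x) *: delta_mx 0 i
                  - row i (stress mu lambda (Du t x)))
      (fun t x => rho t x * f t x 0 i)
      (fun x => rho0 x * u0 x 0 i).

Definition energy_inequality (T mu lambda : R) (rho0 : E3 R -> R)
    (u0 : E3 R -> 'rV[R]_3) (f : R -> E3 R -> 'rV[R]_3)
    (rho : R -> E3 R -> R) (u : R -> E3 R -> 'rV[R]_3)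
    (Du : R -> E3 R -> 'M[R]_3) : Prop :=
  balance_le T (fun t x => energy (rho t x) (u t x))
    (fun t x => (energy (rho t x) (u t x) + pressure (rho t x)) *: u t x
                - u t x *m (stress mu lambda (Du t x))^T)
    (fun t x => vdot (rho t x *: u t x) (f t x)
                - mu * mxnorm (Du t x) ^+ 2
                - (lambda + mu) * (\tr (Du t x)) ^+ 2)
    (fun x => energy (rho0 x) (u0 x)).

Definition weak_solution (mu lambda : R) (rho0 : E3 R -> R)
    (u0 : E3 R -> 'rV[R]_3) (f : R -> E3 R -> 'rV[R]_3)
    (rho : R -> E3 R -> R) (u : R -> E3 R -> 'rV[R]_3) : Prop :=
  [/\ forall t : R, 0 <= t -> periodic P (rho t) /\ periodic P (u t),
      measurable_fun forward (uncurry rho)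
      /\ (forall i, measurable_fun forward (uncurry (fun t x => u t x 0 i))),
      {ae stvol, forall z, forward z -> 0 <= rho z.1 z.2}
    & exists Du : R -> E3 R -> 'M[R]_3,
        [/\ forall t : R, 0 <= t -> periodic P (Du t),
            forall i j,
              measurable_fun forward (uncurry (fun t x => Du t x i j))
          & forall T : R, 0 < T ->
              [/\ weak_gradient T u Du, regularity T rho u Du,
                  mass_equation T rho0 rho u,
                  momentum_equation T mu lambda rho0 u0 f rho u Du
                & energy_inequality T mu lambda rho0 u0 f rho u Du]]].

(** Assumption (CKHw) for the solutions indexed by the viscosities in [mus];
    the constants may depend on [T] but not on [mu]. *)
Definition CKHw (mus : set R) (rho : R -> R -> E3 R -> R)
    (u : R -> R -> E3 R -> 'rV[R]_3) (C kstar beta : R -> R) : Prop :=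
  forall T : R, 0 < T ->
    [/\ 0 < C T, 0 < kstar T, 0 < beta T
      & forall mu, mus mu -> forall k : 'rV[int]_3,
          kstar T <= vnorm (freq P k) ->
          ((vnorm (freq P k) `^ (3 + beta T))%:E *
             \int[leb]_(t in `[0%R, T])
               (fourier_sq P (fun x => state (rho mu t x) (u mu t x)) k)%:E
           <= (C T)%:E)%E].

End navier_stokes.

(* Main.v *)
Require Import Defs.
From HB Require Import structures.
From mathcomp Require Import all_boot all_order all_algebra.
From mathcomp Require Import all_classical all_reals all_analysis.
From mathcomp Require Import measurable_realfun complex.
From mathcomp Require Import ring lra.
Import Order.TTheory GRing.Theory Num.Theory numFieldNormedType.Exports.
Local Open Scope classical_set_scope.
Local Open Scope ring_scope.
Set Implicit Arguments.
Unset Strict Implicit.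
Unset Printing Implicit Defensive.

(** By Fubini, the square of the norm is the sum over the frequencies [k] of
    [(1 + |k|^2)^alpha] times the integral over [0, T] of the squared modulus
    of the coefficient at [k].  That integral is at most [C |k|^-(3 + beta)] for
    [|k| >= kstar] by assumption.  For the finitely many remaining frequencies
    it is bounded by the energy, since [|sqrt rho u|^2] and [(sqrt rho c)^2] are
    bounded by multiples of the energy density ([state_sq_le],
    [fourier_sq_le]).  Both ranges together give the bound
    [Q (1 + |k|^2)^-((3 + beta) / 2)] ([spectral_decay]), and what remains is a
    sum over the lattice of [(1 + |k|^2)^-s] with [s > 3 / 2], which converges
    ([esum_freq_lty]); here [alpha < beta / 2] is used.

    The bound has to be independent of the viscosity, so that the energy must be
    bounded at almost every time by the data alone ([energy_bound]).  The energy
    inequality is tested with a cutoff in time times a product of cutoffs in the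
    space coordinates whose translates by multiples of the period add up to 1.
    Periodicity folds the integrals back to one cell, the fluxes then meet the
    derivative of the constant 1 and disappear ([integral_partition],
    [balance_test]).  As the cutoff in time tends to the indicator of [0, t],
    Lebesgue differentiation turns the averaged inequality into
    [e(t) <= E0 + W] for almost every [t], where [e] is the total energy and [W]
    the integral of the positive part of the source ([ae_le_of_ramp]); [W] is
    finite because the source of a weak solution is integrable.  The dissipation
    has a sign, so that [W] is at most the integral of [|rho u| |f|], and
    Hoelder's inequality with the exponents [2 gamma / (gamma + 1)] and
    [2 gamma / (gamma - 1)] bounds it by a multiple of
    [S^((gamma + 1) / (2 gamma)) |f|] as soon as [e <= S] almost everywhere
    ([force_power_le]).  With [S = E0 + W] this is an inequality
    [S <= E0 + c S^theta] with [theta < 1], which bounds [S]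
    ([sublinear_bound]) and dispenses with a Gronwall argument. *)

(** * Smooth functions and a smooth transition from 0 to 1 *)

Section Ck_closure.
Context {R : realType} {V : normedModType R}.
Implicit Types f g : V -> R.

Lemma Ck_continuous n f : Ck n f -> continuous f.
Proof. by case: n => [|n] []. Qed.

Lemma CkW n f : Ck n.+1 f -> Ck n f.
Proof.
elim: n f => [|n IH] f [cf df]; first by split.
by split=> // v; have [? /IH] := df v.
Qed.

Lemma Ck_cst n (c : R) : Ck n (cst c : V -> R).
Proof.
elim: n c => [|n IH] c; split=> //; try exact: cst_continuous.
move=> v; split=> [x|]; first exact: derivable_cst.
rewrite [X in Ck n X](_ : _ = cst 0); first exact: IH.
by apply/funext => x; rewrite derive_cst.
Qed.

Lemma CkD n f g : Ck n f -> Ck n g -> Ck n (fun x => f x + g x).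
Proof.
elim: n f g => [|n IH] f g [cf df] [cg dg]; (split; first by move=> x; exact: cvgD (cf x) (cg x)) => //.
move=> v; have [df1 df2] := df v; have [dg1 dg2] := dg v; split.
  by move=> x; exact: derivableD.
rewrite [X in Ck n X](_ : _ = fun x => 'D_v f x + 'D_v g x); first exact: IH.
by apply/funext => x; rewrite deriveD.
Qed.

Lemma CkM n f g : Ck n f -> Ck n g -> Ck n (fun x => f x * g x).
Proof.
elim: n f g => [|n IH] f g Cf Cg;
  have [cf df] := Cf; have [cg dg] := Cg;
  (split; first by move=> x; exact: cvgM (cf x) (cg x)) => //.
move=> v; have [df1 df2] := df v; have [dg1 dg2] := dg v; split.
  by move=> x; exact: derivableM.
rewrite [X in Ck n X](_ : _ = fun x => f x * 'D_v g x + g x * 'D_v f x).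
  by apply: CkD; apply: IH => //; exact: CkW.
by apply/funext => x; rewrite deriveM.
Qed.

Lemma CkN n f : Ck n f -> Ck n (fun x => - f x).
Proof.
move=> Cf; rewrite (_ : (fun _ => _) = fun x => -1 * f x).
  by apply: CkM => //; exact: Ck_cst.
by apply/funext => x; rewrite mulN1r.
Qed.

Lemma CkV n f : (forall x, f x != 0) -> Ck n f -> Ck n (fun x => (f x)^-1).
Proof.
move=> f0; elim: n => [|n IH] Cf; have [cf df] := Cf;
  (split; first by move=> x; exact: cvgV (f0 x) (cf x)) => //.
move=> v; have [df1 df2] := df v; split.
  by move=> x; exact: derivableV.
rewrite [X in Ck n X](_ : _ = fun x => (f x)^-1 * (f x)^-1 * - 'D_v f x).
  have := IH (CkW Cf) => ?.
  by apply: CkM; [apply: CkM|apply: CkN].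
by apply/funext => x; rewrite deriveV//= /GRing.scale/= mulrN mulNr -expr2 exprVn.
Qed.

(** Along a line, the composition of [a] with an affine form is [a] read at
    another speed, so that directional derivatives of the composition are
    directional derivatives of [a]. *)
Lemma derive_affine (a : R -> R) (l L : V -> R) :
  (forall h v x, l (h *: v + x) = h * L v + l x) ->
  forall v x, (derivable a (l x) (L v) -> derivable (a \o l) x v) /\
    'D_v (a \o l) x = 'D_(L v) a (l x).
Proof.
move=> lE v x; rewrite /derivable /derive.
suff -> : (fun h : R => h^-1 *: ((a \o l \o shift x) (h *: v) - (a \o l) x)) =
  (fun h : R => h^-1 *: ((a \o shift (l x)) (h *: (L v : R^o)) - a (l x))) by [].
by apply/funext => h /=; rewrite lE.
Qed.

Lemma Ck_affine n (a : R -> R) (l L : V -> R) :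
  (forall h v x, l (h *: v + x) = h * L v + l x) -> continuous l ->
  Ck n a -> Ck n (a \o l).
Proof.
move=> lE cl; elim: n a => [|n IH] a [ca da];
  (split; first by move=> x; apply: continuous_comp; [exact: cl|exact: ca]) => //.
move=> v; have [da1 da2] := da (L v); split=> [x|].
  by apply: (derive_affine a lE v x).1.
rewrite [X in Ck n X](_ : _ = 'D_(L v) a \o l); first exact: IH.
by apply/funext => x; rewrite (derive_affine a lE v x).2.
Qed.

End Ck_closure.

Section flat.
Context {R : realType}.
Implicit Types (p : {poly R}) (s : R).

(** These functions form a space closed under derivation that contains the
    classical function flat at the origin, which is the case [p = 1]. *)
Definition flat_poly p (s : R) : R :=
  if 0 < s then p.[s^-1] * expR (- s^-1) else 0.

(** From [y^n / n! <= expR y] with [y = s^-1].  The linear bound is applied to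
    [flat_poly ('X * p) = s^-1 * flat_poly p], the difference quotient at 0. *)
Lemma flat_poly_bound p : exists2 C, 0 <= C & forall s, 0 <= s ->
  `|flat_poly p s| <= C * s.
Proof.
exists (\sum_(i < size p) `|p`_i| * (i.+1)`!%:R).
  by apply: sumr_ge0 => i _; rewrite mulr_ge0.
move=> s; rewrite le_eqVlt => /predU1P[<-|s0].
  by rewrite /flat_poly ltxx normr0 mulr0.
rewrite /flat_poly s0 normrM (ger0_norm (expR_ge0 _)).
set y := s^-1; have y0 : 0 < y by rewrite invr_gt0.
have ysE : s = y^-1 by rewrite /y invrK.
rewrite horner_coef mulr_suml.
apply: (le_trans (ler_wpM2r (expR_ge0 _) (ler_norm_sum _ _ _))).
rewrite mulr_suml; apply: ler_sum => i _.
rewrite normrM normrX (gtr0_norm y0) -!mulrA ler_wpM2l//.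
rewrite expRN ler_pdivrMr ?expR_gt0// ysE.
have := expR_ge1Dxn i (ltW y0).
set f := _`!%:R; have f0 : 0 < f :> R by rewrite ltr0n fact_gt0.
move=> h; have {}h : y ^+ i.+1 / f <= expR y by apply: le_trans h; rewrite lerDr.
rewrite -ler_pdivrMl; last by rewrite mulr_gt0// invr_gt0.
by rewrite invf_div mulrAC -exprS.
Qed.

Lemma flat_poly_derive p s :
  is_derive s 1 (flat_poly p) (flat_poly ('X^2 * (p - p^`())) s).
Proof.
have [s0|s0|->] := ltgtP s 0.
- rewrite {2}/flat_poly ltNge (ltW s0)/=.
  apply: (@near_eq_is_derive _ _ _ (cst 0)) => //.
    near=> t; rewrite /flat_poly ltNge.
    have -> // : t <= 0.
    by apply/ltW; near: t; exact: lt_nbhsl.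
- rewrite {2}/flat_poly s0.
  apply: (@near_eq_is_derive _ _ _ (fun t : R => p.[t^-1] * expR (- t^-1))).
    near=> t; rewrite /flat_poly; have -> // : 0 < t; near: t.
    exact: lt_nbhsr.
  have s0' : s != 0 by rewrite gt_eqF.
  have dV : is_derive s 1 (fun t : R => t^-1) (- s ^- 2 *: 1).
    exact: (@is_deriveV R id s 1 1).
  have dp : is_derive s 1 (fun t : R => p.[t^-1]) (p^`().[s^-1] * (- s ^- 2 *: 1)).
    by apply: (@is_derive1_comp R (horner p) (fun t : R => t^-1)).
  have dV' : is_derive s 1 (fun t : R => - t^-1) (- (- s ^- 2 *: 1)).
    exact: is_deriveN.
  have de : is_derive s 1 (fun t : R => expR (- t^-1))
      (expR (- s^-1) * - (- s ^- 2 *: 1)).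
    by apply: (@is_derive1_comp R expR (fun t : R => - t^-1)).
  apply: is_derive_eq (is_deriveM dp de) _.
  rewrite !hornerE /GRing.scale/= exprVn.
  ring.
(* At the origin the difference quotient itself is a function of the family. *)
have [C C0 HC] := flat_poly_bound ('X * p).
have cvg0 : h^-1 *: ((flat_poly p \o shift 0) (h *: 1) - flat_poly p 0)
    @[h --> 0^'] --> (0 : R).
  apply/cvgr0Pnorm_lt => e e0; near=> h.
  have h0 : h != 0 by near: h; exact: nbhs_dnbhs_neq.
  have he : `|h| < e / (C + 1).
    near: h; apply: dnbhs0_lt; by rewrite divr_gt0// ltr_wpDl.
  rewrite {2}/flat_poly ltxx subr0 /= addr0 /GRing.scale/= mulr1.
  have [hpos|hneg] := ltP 0 h; last first.
    by rewrite /flat_poly (ltNge 0) hneg/= mulr0 normr0.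
  have -> : h^-1 * flat_poly p h = flat_poly ('X * p) h.
    by rewrite /flat_poly hpos hornerM hornerX mulrA.
  apply: (le_lt_trans (HC h (ltW hpos))).
  rewrite -(gtr0_norm hpos); apply: (@le_lt_trans _ _ ((C + 1) * `|h|)).
    by rewrite ler_wpM2r// lerDl.
  by rewrite -ltr_pdivlMl ?ltr_wpDl// mulrC.
rewrite {2}/flat_poly ltxx; split; first by apply/cvg_ex; exists 0.
exact/cvg_lim.
Unshelve. all: end_near.
Qed.

Lemma flat_poly_Ck n p : Ck n (flat_poly p : R -> R).
Proof.
have df s q : derivable (flat_poly q) s 1 by have [] := flat_poly_derive q s.
have dif s q : differentiable (flat_poly q) s by apply/derivable1_diffP.
elim: n p => [|n IH] p; (split; first by move=> s; exact: differentiable_continuous) => //.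
move=> v; split => [s|]; first exact: diff_derivable.
rewrite [X in Ck n X](_ : _ = fun s => v * flat_poly ('X^2 * (p - p^`())) s).
  by apply: CkM => //; exact: Ck_cst.
apply/funext => s; rewrite deriveE// -[v in LHS]mulr1 linearZ/= -deriveE//.
by have [_ ->] := flat_poly_derive p s.
Qed.
End flat.

Section smooth_step.
Context {R : realType}.
Implicit Type s : R.

Definition flat s : R := flat_poly 1 s.

Lemma flat_ge0 s : 0 <= flat s.
Proof.
by rewrite /flat /flat_poly; case: ifP => // _; rewrite hornerE mul1r expR_ge0.
Qed.

Lemma flat_gt0 s : 0 < s -> 0 < flat s.
Proof. by move=> s0; rewrite /flat /flat_poly s0 hornerE mul1r expR_gt0. Qed.

Lemma flat_eq0 s : s <= 0 -> flat s = 0.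
Proof. by move=> s0; rewrite /flat /flat_poly ltNge s0. Qed.

(** The denominator never vanishes, so that smoothness is inherited from [flat]
    by closure under products and inverses. *)
Definition step s : R := flat s / (flat s + flat (1 - s)).

Lemma step_den_gt0 s : 0 < flat s + flat (1 - s).
Proof.
have [s0|s0] := ltP 0 s; first by rewrite ltr_wpDr ?flat_ge0 ?flat_gt0.
by rewrite ltr_wpDl ?flat_ge0 ?flat_gt0// subr_gt0 (le_lt_trans s0).
Qed.

Lemma step_eq0 s : s <= 0 -> step s = 0.
Proof. by move=> s0; rewrite /step flat_eq0// mul0r. Qed.

Lemma step_eq1 s : 1 <= s -> step s = 1.
Proof.
move=> s1; rewrite /step [flat (1 - s)]flat_eq0 ?subr_le0// addr0 divff//.
by rewrite gt_eqF// flat_gt0// (lt_le_trans ltr01).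
Qed.

Lemma step_itv s : 0 <= step s <= 1.
Proof.
rewrite /step divr_ge0 ?flat_ge0 ?(ltW (step_den_gt0 _))//=.
by rewrite ler_pdivrMr ?step_den_gt0// mul1r lerDl flat_ge0.
Qed.

Lemma step_Ck n : Ck n (step : R -> R).
Proof.
apply: CkM; first exact: flat_poly_Ck.
apply: CkV => [s|]; first by rewrite gt_eqF ?step_den_gt0.
apply: CkD; first exact: flat_poly_Ck.
apply: (@Ck_affine _ _ n flat (fun s => 1 - s) (fun s => - s)).
- by move=> h v x /=; rewrite /GRing.scale/=; ring.
- by move=> x; apply: cvgB; [exact: cvg_cst|exact: cvg_id].
- exact: flat_poly_Ck.
Qed.

(** For [d > 0] it rises from 0 at [a] to 1 at [a + d]. *)
Definition ramp (a d s : R) : R := step (d^-1 * (s - a)).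

Lemma ramp_Ck n a d : Ck n (ramp a d : R -> R).
Proof.
apply: (@Ck_affine _ _ n step (fun s => d^-1 * (s - a)) (fun s => d^-1 * s)).
- by move=> h v x /=; rewrite /GRing.scale/=; ring.
- move=> x; apply: cvgM; first exact: cvg_cst.
  by apply: cvgB; [exact: cvg_id|exact: cvg_cst].
- exact: step_Ck.
Qed.

Lemma ramp_eq0 a d s : 0 < d -> s <= a -> ramp a d s = 0.
Proof.
move=> d0 sa; rewrite /ramp step_eq0//.
by apply: mulr_ge0_le0; rewrite ?subr_le0// invr_ge0 ltW.
Qed.

Lemma ramp_eq1 a d s : 0 < d -> a + d <= s -> ramp a d s = 1.
Proof.
by move=> d0 sa; rewrite /ramp step_eq1// mulrC ler_pdivlMr// mul1r lerBrDl.
Qed.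

Lemma ramp_itv a d s : 0 <= ramp a d s <= 1.
Proof. exact: step_itv. Qed.

Lemma ramp_shift a d s c : ramp a d (s + c) = ramp (a - c) d s.
Proof. by rewrite /ramp; congr (step (_ * _)); ring. Qed.

Lemma derive_ramp a d s : 'D_1 (ramp a d) s = d^-1 * 'D_1 step (d^-1 * (s - a)).
Proof.
have lE (h v x : R) : d^-1 * (h *: v + x - a) = h * (d^-1 * v) + d^-1 * (x - a).
  by rewrite /GRing.scale/=; ring.
have [_ dstep] := step_Ck 1.
have /= := (derive_affine step lE 1 s).2; rewrite mulr1 => ->.
set t := d^-1 * (s - a).
have ? : differentiable step t by apply/derivable1_diffP; have [] := dstep 1.
by rewrite deriveE// -{1}[d^-1]mulr1 linearZ/= -deriveE.
Qed.

(** Outside [[0, 1]] the function is locally constant, except possibly at the two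
    ends, which belong to the compact interval where the derivative is
    continuous. *)
Lemma derive_step_bound : exists2 K, 0 < K & forall s, `|'D_1 step s| <= K.
Proof.
have [dstep [cstep _]] := (step_Ck 1).2 1.
have [c _ cmax] : exists2 c, c \in `[0%R, 1%R] &
    forall t, t \in `[0%R, 1%R] -> `|'D_1 step t| <= `|'D_1 step c|.
  apply: (@EVT_max _ (fun t => `|'D_1 step t|) 0 1) => //.
  apply: continuous_subspaceT => t.
  by apply: cvg_norm; exact: cstep.
have D0 (a : R) s : (\near s, step s = a) -> 'D_1 step s = 0.
  by move=> sa; rewrite (@near_eq_derive _ _ _ step (cst a))// derive_cst.
exists (`|'D_1 step c| + 1); first by rewrite ltr_wpDl.
move=> s; have [s0|s0] := ltP s 0.
  rewrite (D0 0) ?normr0 ?addr_ge0//; near=> t.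
  by rewrite step_eq0//; apply/ltW; near: t; exact: lt_nbhsl.
have [s1|s1] := ltP 1 s.
  rewrite (D0 1) ?normr0 ?addr_ge0//; near=> t.
  by rewrite step_eq1//; apply/ltW; near: t; exact: lt_nbhsr.
apply: (le_trans (cmax s _)); last by rewrite lerDl.
by rewrite in_itv/= s0.
Unshelve. all: end_near.
Qed.

End smooth_step.

(** * Measure-preserving translations and folding of integrals *)

Section measure_preserving.

Lemma measurable_preimT d1 d2 (T1 : measurableType d1) (T2 : measurableType d2)
  (f : T1 -> T2) A : measurable_fun setT f -> measurable A ->
  measurable (f @^-1` A).
Proof. by move=> mf mA; rewrite -[X in measurable X]setTI; exact: mf. Qed.

Definition preserving d (T : measurableType d) (R : realType)
    (mu : set T -> \bar R) (tau : T -> T) :=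
  measurable_fun setT tau /\
  forall A, measurable A -> mu (tau @^-1` A) = mu A.

Lemma preserving_id d (T : measurableType d) (R : realType)
  (mu : set T -> \bar R) : preserving mu id.
Proof. by []. Qed.

(** A measure on a product is determined by its values on rectangles. *)
Lemma preserving_prod d1 d2 (T1 : measurableType d1) (T2 : measurableType d2)
    (R : realType) (m1 : {sigma_finite_measure set T1 -> \bar R})
    (m2 : {sigma_finite_measure set T2 -> \bar R}) t1 t2 :
  preserving m1 t1 -> preserving m2 t2 ->
  preserving (m1 \x m2)%E (fun z => (t1 z.1, t2 z.2)).
Proof.
move=> [mt1 h1] [mt2 h2].
have mt : measurable_fun setT (fun z : T1 * T2 => (t1 z.1, t2 z.2)).
  apply: measurable_fun_pair.
    exact: measurableT_comp.
  exact: measurableT_comp.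
pose mft := isMeasurableFun.Build _ _ _ _ _ mt.
pose t : {mfun (T1 * T2)%type >-> (T1 * T2)%type} := HB.pack (fun z : T1 * T2 => (t1 z.1, t2 z.2)) mft.
split=> // A mA.
rewrite -[LHS]/(pushforward (m1 \x m2)%E t A).
apply/esym/product_measure_unique => // B C mB mC.
rewrite -[LHS]/((m1 \x m2)%E ((t1 @^-1` B) `*` (t2 @^-1` C))).
rewrite product_measure1E; [|exact: measurable_preimT..].
by congr (_ * _)%E; [exact: h1|exact: h2].
Qed.

Lemma preserving_shift (R : realType) (c : R) :
  preserving (@leb R) (fun s => s + c).
Proof.
have mt : @measurable_fun _ _ (measurableTypeR R) (measurableTypeR R) setT
    (fun s => s + c) by exact: measurable_funD.
pose mft := isMeasurableFun.Build _ _ _ _ _ mt.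
pose t : {mfun (measurableTypeR R) >-> (measurableTypeR R)} := HB.pack (fun s : R => s + c) mft.
split=> // A mA.
rewrite -[LHS]/(pushforward (@leb R) t A).
apply/esym/lebesgue_measure_unique => // _ [[a b] _ <-].
rewrite -[RHS]/(leb ((fun s => s + c) @^-1` `]a, b]%classic)).
have -> : (fun s => s + c) @^-1` `]a, b]%classic = `]a - c, b - c]%classic.
  by apply/seteqP; split => s; rewrite /= !in_itv/=; lra.
rewrite /leb /= !lebesgue_measure_itv/= !lte_fin ltrBlDr subrK.
by case: ifP => // _; rewrite -!EFinD; congr (_%:E); ring.
Qed.

Lemma integral_preserving d (T : measurableType d) (R : realType)
    (mu : {measure set T -> \bar R}) tau (D : set T) (f : T -> \bar R) :
  preserving mu tau -> measurable D -> mu.-integrable D f ->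
  mu.-integrable (tau @^-1` D) (f \o tau) /\
  (\int[mu]_(x in D) f x = \int[mu]_(x in tau @^-1` D) f (tau x))%E.
Proof.
move=> [mt ht] mD fD.
pose mft := isMeasurableFun.Build _ _ _ _ _ mt.
pose t : {mfun T >-> T} := HB.pack tau mft.
have mtD : measurable (tau @^-1` D) by exact: measurable_preimT.
have [mf foo] := (integrableP _ _ _ fD).
have eqm A : measurable A -> A `<=` D -> mu A = pushforward mu t A.
  by move=> mA _; rewrite /pushforward/= ht.
have itau : mu.-integrable (tau @^-1` D) (f \o tau).
  apply/integrableP; split.
    apply: (measurable_comp mD _ mf); first by move=> _ [x /= Dx <-].
    exact: measurable_funTS.
  rewrite (eq_measure_integral _ eqm) in foo.
  rewrite (@ge0_integral_pushforward _ _ _ _ _ tau mt mu D (abse \o f)) in foo => //.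
    exact: measurableT_comp.
  by move=> x _; exact: abse_ge0.
split=> //.
rewrite (eq_measure_integral _ eqm).
rewrite (integral_mkcond D) (integral_mkcond (tau @^-1` D)).
rewrite (@integral_pushforward _ _ _ _ _ tau mt mu setT (f \_ D)) ?preimage_setT//.
- exact/(measurable_restrictT _ mD).
- rewrite -(_ : (f \o tau) \_ (tau @^-1` D) = (f \_ D) \o tau); last first.
    by apply/funext => x; rewrite /= !patchE.

  exact/(integrable_mkcond _ mtD).
Qed.

End measure_preserving.

Section folding.
Context d (T : measurableType d) (R : realType)
  (mu : {measure set T -> \bar R}).
Variables (P : R) (sigma : T -> T) (c : T -> R) (D : set T).
Hypotheses (psigma : preserving mu sigma).
Hypotheses (mc : measurable_fun setT c) (csigma : forall z, c (sigma z) = c z - P).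
Hypothesis (null : mu [set z | c z = P / 2] = 0%E).
Hypotheses (mD : measurable D) (Dsigma : forall z, D (sigma z) <-> D z).

Let D1 := D `&` [set z | - (P / 2) <= c z <= P / 2].

(** The translation by one period maps the second of two consecutive periods
    onto the first one and preserves the measure.  The coordinate [c] is treated
    as an arbitrary function so that the lemma applies to space as well as to
    space-time, one direction at a time. *)
Lemma integral_fold (G A : T -> R) :
  mu.-integrable D (EFin \o G) ->
  (forall z, D z -> ~~ (- (3 / 2 * P) <= c z < P / 2) -> G z = 0) ->
  (forall z, D z -> - (P / 2) <= c z < P / 2 -> G z + G (sigma z) = A z) ->
  measurable_fun D1 A ->
  [/\ measurable D1, mu.-integrable D1 (EFin \o A) &
  (\int[mu]_(z in D) (G z)%:E = \int[mu]_(z in D1) (A z)%:E)%E].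
Proof.
move=> iG G0 GA mA.
have mcs (i : interval R) : measurable (c @^-1` [set` i]).
  exact: measurable_preimT.
pose E0 := D `&` c @^-1` `[- (3 / 2 * P), - (P / 2)[%classic.
pose E1 := D `&` c @^-1` `[- (P / 2), P / 2[%classic.
have mE0 : measurable E0 by exact: measurableI.
have mE1 : measurable E1 by exact: measurableI.
have mD1 : measurable D1.
  rewrite /D1 (_ : [set z | _] = c @^-1` `[- (P / 2), P / 2]%classic).
    exact: measurableI.
  by apply/seteqP; split => z /=; rewrite in_itv.
have D1E : D1 `\` [set z | c z = P / 2] = E1.
  apply/seteqP; split=> z /=.
    move=> [[Dz /andP[c1 c2]] /eqP c3]; split=> //=.
    by rewrite in_itv/= c1 lt_neqAle c3.
  move=> [Dz]; rewrite /= in_itv/= => /andP[c1 c2]; split.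
    by split=> //; rewrite /= c1 ltW.
  by move=> cz; rewrite cz ltxx in c2.
have E01 : [disjoint E0 & E1].
  apply/disj_setPS => z [[_ +] [_ +]]; rewrite /= !in_itv/= => /andP[_ c1] /andP[c2 _].
  by have := lt_le_trans c1 c2; rewrite ltxx.
have sE0 : sigma @^-1` E0 = E1.
  apply/seteqP; split => z; rewrite /E0 /E1 /= !in_itv/= csigma Dsigma;
    by move=> [Dz /andP[c1 c2]]; split => //; lra.
have iG0 : mu.-integrable E0 (EFin \o G) by apply: integrableS iG => //; by exact: subIsetl.
have iG1 : mu.-integrable E1 (EFin \o G) by apply: integrableS iG => //; by exact: subIsetl.
have [iGs iGE] := integral_preserving psigma mE0 iG0.
rewrite sE0 in iGs iGE.
have iAE1 : mu.-integrable E1 (EFin \o A).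
  apply: (@eq_integrable _ _ _ _ _ _ ((EFin \o G) \+ (EFin \o G \o sigma))%E) => //.
    move=> z /set_mem [Dz /=]; rewrite in_itv/= => cz.
    by rewrite -EFinD GA.
  exact: integrableD.
have mnull : measurable [set z | c z = P / 2].
  rewrite (_ : [set z | _] = c @^-1` [set P / 2])//.
  exact: measurable_preimT.
have iA : mu.-integrable D1 (EFin \o A).
  apply/(negligible_integrable mnull mD1); rewrite ?D1E//.
  exact/measurable_EFinP.
split => //.
transitivity (\int[mu]_(z in E0 `|` E1) (G z)%:E)%E.
  rewrite [LHS]integral_mkcond [RHS]integral_mkcond; apply: eq_integral => z _.
  rewrite !patchE; case: ifPn; case: ifPn => //.
  - move=> nE /set_mem Dz; rewrite G0//; apply: contra nE => cz.
    rewrite inE /E0 /E1 /= !in_itv/=.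
    by have [] := ltP (c z) (- (P / 2)) => ?; [left|right]; split => //; lra.
  - by move=> /set_mem[] [Dz _] /negP; rewrite inE.
rewrite integral_setU//; last first.
  by apply/measurable_funU => //; split; [exact: measurable_int iG0|exact: measurable_int iG1].
rewrite iGE -integralD//.
rewrite (negligible_integral mnull mD1 iA null) D1E.
apply: eq_integral => z /set_mem [Dz /=]; rewrite in_itv/= => cz.
by rewrite -EFinD addrC GA.
Qed.

End folding.

(** * Periodic partitions of unity *)

Section partition.
Context d (T : measurableType d) (R : realType)
  (mu : {measure set T -> \bar R}).
Variables (P : R) (s1 s2 s3 : T -> T) (c1 c2 c3 : T -> R) (D : set T).
Hypotheses (mD : measurable D).
Hypotheses (ps1 : preserving mu s1) (ps2 : preserving mu s2)
  (ps3 : preserving mu s3).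
Hypotheses (mc1 : measurable_fun setT c1) (mc2 : measurable_fun setT c2)
  (mc3 : measurable_fun setT c3).
Hypotheses (c1s1 : forall z, c1 (s1 z) = c1 z - P)
  (c2s2 : forall z, c2 (s2 z) = c2 z - P)
  (c3s3 : forall z, c3 (s3 z) = c3 z - P).
Hypotheses (c2s1 : forall z, c2 (s1 z) = c2 z) (c3s1 : forall z, c3 (s1 z) = c3 z)
  (c1s2 : forall z, c1 (s2 z) = c1 z) (c3s2 : forall z, c3 (s2 z) = c3 z)
  (c1s3 : forall z, c1 (s3 z) = c1 z) (c2s3 : forall z, c2 (s3 z) = c2 z).
Hypotheses (null1 : mu [set z | c1 z = P / 2] = 0%E)
  (null2 : mu [set z | c2 z = P / 2] = 0%E)
  (null3 : mu [set z | c3 z = P / 2] = 0%E).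
Hypotheses (Ds1 : forall z, D (s1 z) <-> D z) (Ds2 : forall z, D (s2 z) <-> D z)
  (Ds3 : forall z, D (s3 z) <-> D z).
Variables (chi dchi : R -> R).
Hypotheses (mchi : measurable_fun setT chi) (mdchi : measurable_fun setT dchi).
Hypotheses (chi0 : forall s, ~~ (- (3 / 2 * P) <= s < P / 2) -> chi s = 0)
  (dchi0 : forall s, ~~ (- (3 / 2 * P) <= s < P / 2) -> dchi s = 0).
Hypotheses (chi1 : forall s, - (P / 2) <= s < P / 2 -> chi s + chi (s - P) = 1)
  (dchi1 : forall s, - (P / 2) <= s < P / 2 -> dchi s + dchi (s - P) = 0).
Variables (a F1 F2 F3 : T -> R).
Hypotheses (ma : measurable_fun D a)
  (mF2 : measurable_fun D F2) (mF3 : measurable_fun D F3).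
Hypotheses (as1 : forall z, D z -> a (s1 z) = a z) (as2 : forall z, D z -> a (s2 z) = a z)
  (as3 : forall z, D z -> a (s3 z) = a z).
Hypotheses (F1s1 : forall z, D z -> F1 (s1 z) = F1 z)
  (F2s1 : forall z, D z -> F2 (s1 z) = F2 z) (F3s1 : forall z, D z -> F3 (s1 z) = F3 z).
Hypotheses (F2s2 : forall z, D z -> F2 (s2 z) = F2 z)
  (F3s2 : forall z, D z -> F3 (s2 z) = F3 z) (F3s3 : forall z, D z -> F3 (s3 z) = F3 z).

Let G z := a z * (chi (c1 z) * chi (c2 z) * chi (c3 z))
  + F1 z * (dchi (c1 z) * chi (c2 z) * chi (c3 z))
  + F2 z * (chi (c1 z) * dchi (c2 z) * chi (c3 z))
  + F3 z * (chi (c1 z) * chi (c2 z) * dchi (c3 z)).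

Let period (c : T -> R) := [set z | - (P / 2) <= c z <= P / 2].

(** Fold one direction after the other: in each of them the cutoff and its
    translate add up to 1 and their derivatives to 0, so that every term that
    differentiates the cutoff of that direction drops out. *)
Lemma integral_partition : mu.-integrable D (EFin \o G) ->
  [/\ measurable (D `&` period c1 `&` period c2 `&` period c3),
    mu.-integrable (D `&` period c1 `&` period c2 `&` period c3) (EFin \o a) &
  (\int[mu]_(z in D) (G z)%:E =
    \int[mu]_(z in D `&` period c1 `&` period c2 `&` period c3) (a z)%:E)%E].
Proof.
move=> iG.
have mk c : measurable_fun setT c -> measurable_fun D (chi \o c).
  by move=> mc; apply: measurable_funTS; exact: measurableT_comp.
have mdk c : measurable_fun setT c -> measurable_fun D (dchi \o c).
  by move=> mc; apply: measurable_funTS; exact: measurableT_comp.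
pose G1 z := a z * (chi (c2 z) * chi (c3 z))
  + F2 z * (dchi (c2 z) * chi (c3 z)) + F3 z * (chi (c2 z) * dchi (c3 z)).
pose G2 z := a z * chi (c3 z) + F3 z * dchi (c3 z).
have [mD1 iG1 ->] : [/\ measurable (D `&` period c1),
    mu.-integrable (D `&` period c1) (EFin \o G1) &
  (\int[mu]_(z in D) (G z)%:E =
    \int[mu]_(z in D `&` period c1) (G1 z)%:E)%E].
  apply: (@integral_fold _ _ _ mu P s1 c1 D ps1 mc1 c1s1 null1 mD Ds1 G G1 iG).
  - by move=> z Dz cz; rewrite /G chi0// dchi0//; ring.
  - move=> z Dz cz; have k1 := chi1 cz; have k2 := dchi1 cz.
    rewrite /G /G1 c1s1 c2s1 c3s1 as1// F1s1// F2s1// F3s1//.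
    have -> : chi (c1 z - P) = 1 - chi (c1 z) by rewrite -k1; ring.
    have -> : dchi (c1 z - P) = - dchi (c1 z) by lra.
    ring.
  - apply: (@measurable_funS _ _ _ _ D) => //.
    by do 2?apply: measurable_funD; apply: measurable_funM => //;
      apply: measurable_funM; first [exact: mk|exact: mdk].
have D2 z : (D `&` period c1) (s2 z) <-> (D `&` period c1) z.
  by rewrite /period /= c1s2; split => -[/Ds2 ? ?]; split => //; exact/Ds2.
have D3 z : (D `&` period c1 `&` period c2) (s3 z) <->
    (D `&` period c1 `&` period c2) z.
  rewrite /period /= c1s3 c2s3.
  by split => -[[/Ds3 ? ?] ?]; split => //; split => //; exact/Ds3.
have [mD2 iG2 ->] : [/\ measurable (D `&` period c1 `&` period c2),
    mu.-integrable (D `&` period c1 `&` period c2) (EFin \o G2) &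
  (\int[mu]_(z in D `&` period c1) (G1 z)%:E =
    \int[mu]_(z in D `&` period c1 `&` period c2) (G2 z)%:E)%E].
  apply: (@integral_fold _ _ _ mu P s2 c2 _ ps2 mc2 c2s2 null2 mD1 D2 G1 G2 iG1).
  - by move=> z Dz cz; rewrite /G1 chi0// dchi0//; ring.
  - move=> z [Dz _] cz; have k1 := chi1 cz; have k2 := dchi1 cz.
    rewrite /G1 /G2 c2s2 c3s2 as2// F2s2// F3s2//.
    have -> : chi (c2 z - P) = 1 - chi (c2 z) by rewrite -k1; ring.
    have -> : dchi (c2 z - P) = - dchi (c2 z) by lra.
    ring.
  - apply: (@measurable_funS _ _ _ _ D) => //; first by do 2 (apply: subIset; left).
    by apply: measurable_funD; apply: measurable_funM => //; first [exact: mk|exact: mdk].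
apply: (@integral_fold _ _ _ mu P s3 c3 _ ps3 mc3 c3s3 null3 mD2 D3 G2 a iG2).
- by move=> z Dz cz; rewrite /G2 chi0// dchi0//; ring.
- move=> z [[Dz _] _] cz; have k1 := chi1 cz; have k2 := dchi1 cz.
  rewrite /G2 c3s3 as3// F3s3//.
  have -> : chi (c3 z - P) = 1 - chi (c3 z) by rewrite -k1; ring.
  have -> : dchi (c3 z - P) = - dchi (c3 z) by lra.
  ring.
- by apply: (@measurable_funS _ _ _ _ D) => //; do 3 (apply: subIset; left).
Qed.

End partition.

Section cutoff.
Context {R : realType}.
Variable P : R.
Hypothesis P0 : 0 < P.

(** The translates of this cutoff by the multiples of [P] add up to 1, because
    it is the difference of two translates of a transition from 0 to 1.  The
    transition takes place in the middle half of a period, which makes the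
    identity locally exact at the ends of the period as well. *)
Definition cutoff (s : R) : R :=
  ramp (- (5 / 4 * P)) (P / 2) s - ramp (- (P / 4)) (P / 2) s.

Let P20 : 0 < P / 2. Proof. by rewrite divr_gt0. Qed.

Lemma cutoff_Ck n : Ck n (cutoff : R -> R).
Proof. by apply: CkD; [exact: ramp_Ck|apply: CkN; exact: ramp_Ck]. Qed.

Lemma cutoff_eq0 s : ~~ (- (5 / 4 * P) < s < P / 4) -> cutoff s = 0.
Proof.
rewrite /cutoff; have [h|h] := leP s (- (5 / 4 * P)) => /=.
  by move=> _; rewrite !ramp_eq0 ?subr0//; have := P0; lra.
by rewrite -leNgt => h'; rewrite !ramp_eq1 ?subrr//; have := P0; lra.
Qed.

Lemma cutoff_add s : - (3 / 4 * P) <= s <= 3 / 4 * P -> cutoff s + cutoff (s - P) = 1.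
Proof.
move=> /andP[h1 h2]; rewrite /cutoff !(ramp_shift _ _ s (- P)).
rewrite (@ramp_eq1 _ (- (5 / 4 * P)))//; last by have := P0; lra.
rewrite (@ramp_eq0 _ (- (P / 4) - - P))//; last by have := P0; lra.
by rewrite (_ : - (5 / 4 * P) - - P = - (P / 4)); [ring|field].
Qed.

Lemma cutoff_ge0 s : 0 <= cutoff s.
Proof.
have /andP[r0 r1] := ramp_itv (- (5 / 4 * P)) (P / 2) s.
have /andP[r0' r1'] := ramp_itv (- (P / 4)) (P / 2) s.
rewrite /cutoff; have [h|h] := leP s (- (P / 4)).
  by rewrite (@ramp_eq0 _ (- (P / 4)))// subr0.
by rewrite (@ramp_eq1 _ (- (5 / 4 * P))) ?subr_ge0//; have := P0; lra.
Qed.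

Lemma derivable_cutoff s : derivable cutoff s 1.
Proof. by have [_ /(_ 1)[]] := cutoff_Ck 1. Qed.

Lemma derive_cutoff_eq0 s : ~~ (- (3 / 2 * P) <= s < P / 2) -> 'D_1 cutoff s = 0.
Proof.
move=> h; rewrite (@near_eq_derive _ _ _ cutoff (cst 0)) ?derive_cst//.
have [hs|hs] := ltP s (- (3 / 2 * P)).
  near=> t; rewrite cutoff_eq0//; apply/negP => /andP[t1 _].
  have : t < - (3 / 2 * P) by near: t; exact: lt_nbhsl.
  by have := P0; lra.
have {}h : P / 2 <= s by move: h; rewrite hs/= -leNgt.
near=> t; rewrite cutoff_eq0//; apply/negP => /andP[_ t1].
have : P / 4 < t by near: t; apply: lt_nbhsr; have := P0; lra.
by have := P0; lra.
Unshelve. all: end_near.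
Qed.

Lemma derive_cutoff_add s : - (P / 2) <= s < P / 2 ->
  'D_1 cutoff s + 'D_1 cutoff (s - P) = 0.
Proof.
move=> /andP[h1 h2].
have sE (h v x : R) : h *: v + x - P = h * v + (x - P) by rewrite addrA.
have [d1 d2] := derive_affine cutoff sE 1 s.
rewrite -d2 -deriveD; [|exact: derivable_cutoff|exact/d1/derivable_cutoff].
rewrite (@near_eq_derive _ _ R^o _ (cst 1 : R -> R^o)) ?derive_cst//.
near=> t; rewrite -[LHS]/(cutoff t + cutoff (t - P)) cutoff_add//.
apply/andP; split; apply/ltW; near: t.
  by apply: lt_nbhsr; have := P0; lra.
by apply: lt_nbhsl; have := P0; lra.
Unshelve. all: end_near.
Qed.

End cutoff.

(** * Cells, translations and coordinate planes *)

Section coordinates.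
Context {R : realType}.
Implicit Types (x : E3 R) (P c : R).
Let B := measurableTypeR R.

Definition shift1 P x : E3 R := (x.1.1 - P, x.1.2, x.2).
Definition shift2 P x : E3 R := (x.1.1, x.1.2 - P, x.2).
Definition shift3 P x : E3 R := (x.1, x.2 - P).

Lemma preserving_shift1 P : preserving (@vol R) (shift1 P).
Proof.
exact: (@preserving_prod _ _ _ _ _ (@leb2 R) leb _ _
  (@preserving_prod _ _ _ _ _ leb leb _ _ (preserving_shift (- P))
     (preserving_id leb)) (preserving_id leb)).
Qed.

Lemma preserving_shift2 P : preserving (@vol R) (shift2 P).
Proof.
exact: (@preserving_prod _ _ _ _ _ (@leb2 R) leb _ _
  (@preserving_prod _ _ _ _ _ leb leb _ _ (preserving_id leb)
     (preserving_shift (- P))) (preserving_id leb)).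
Qed.

Lemma preserving_shift3 P : preserving (@vol R) (shift3 P).
Proof.
exact: (@preserving_prod _ _ _ _ _ (@leb2 R) leb _ _
  (preserving_id (@leb2 R)) (preserving_shift (- P))).
Qed.

Lemma preserving_st (tau : E3 R -> E3 R) : preserving (@vol R) tau ->
  preserving (@stvol R) (fun z => (z.1, tau z.2)).
Proof.
move=> pt; exact: (@preserving_prod _ _ _ _ _ leb (@vol R) _ _ (preserving_id leb) pt).
Qed.

Lemma leb_set1 c : @leb R [set c] = 0%E.
Proof. exact: lebesgue_measure_set1. Qed.

Lemma null_plane1 c : @vol R [set x | x.1.1 = c] = 0%E.
Proof.
have -> : [set x : E3 R | x.1.1 = c] = ([set c] `*` setT) `*` setT.
  by apply/seteqP; split => [[[x y] z] /= ->|[[x y] z] [[]]].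
rewrite -[LHS]/((@leb2 R \x leb)%E _) product_measure1E//; last exact: measurableX.
rewrite -[X in (X * _)%E]/((leb \x leb)%E _) product_measure1E//.
by rewrite [X in (X * _ * _)%E]leb_set1 !mul0e.
Qed.

Lemma null_plane2 c : @vol R [set x | x.1.2 = c] = 0%E.
Proof.
have -> : [set x : E3 R | x.1.2 = c] = (setT `*` [set c]) `*` setT.
  by apply/seteqP; split => [[[x y] z] /= ->|[[x y] z] [[]]].
rewrite -[LHS]/((@leb2 R \x leb)%E _) product_measure1E//; last exact: measurableX.
rewrite -[X in (X * _)%E]/((leb \x leb)%E _) product_measure1E//.
by rewrite [X in (_ * X * _)%E]leb_set1 mule0 mul0e.
Qed.

Lemma null_plane3 c : @vol R [set x | x.2 = c] = 0%E.
Proof.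
have -> : [set x : E3 R | x.2 = c] = setT `*` [set c].
  by apply/seteqP; split => [[[x y] z] /= ->|[[x y] z] []].
rewrite -[LHS]/((@leb2 R \x leb)%E _) product_measure1E//.
by rewrite [X in (_ * X)%E]leb_set1 mule0.
Qed.

Lemma null_st (A : set (E3 R)) : measurable A -> @vol R A = 0%E ->
  @stvol R [set z | A z.2] = 0%E.
Proof.
move=> mA A0; have -> : [set z : R * E3 R | A z.2] = setT `*` A.
  by apply/seteqP; split => [[t x]|[t x] []].
rewrite -[LHS]/((leb \x vol)%E _) product_measure1E//.
by rewrite [X in (_ * X)%E]A0 mule0.
Qed.

Lemma measurable_x1 : measurable_fun setT (fun x => x.1.1).
Proof. exact: measurableT_comp. Qed.
Lemma measurable_x2 : measurable_fun setT (fun x => x.1.2).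
Proof. exact: measurableT_comp. Qed.
Lemma measurable_x3 : measurable_fun setT (fun x => x.2).
Proof. exact: measurable_snd. Qed.

Lemma cellE P : cell P = `[- (P / 2), P / 2]%classic `*` `[- (P / 2), P / 2]%classic
   `*` `[- (P / 2), P / 2]%classic.
Proof.
apply/seteqP; split => [[[x y] z] h|[[x y] z] [[h1 h2] h3] [[|[|[|//]]] i]].
- split; [split|]; rewrite /= in_itv/=.
  + exact: (h ord0).
  + by have := h (inord 1); rewrite /xcoord inordK.
  + by have := h (inord 2); rewrite /xcoord inordK.
- by move: h1; rewrite /= in_itv.
- by move: h2; rewrite /= in_itv.
- by move: h3; rewrite /= in_itv.
Qed.

Lemma cell_triple P x : - (3 / 2 * P) <= x.1.1 <= 3 / 2 * P ->
  - (3 / 2 * P) <= x.1.2 <= 3 / 2 * P -> - (3 / 2 * P) <= x.2 <= 3 / 2 * P ->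
  cell (3 * P) x.
Proof. by move=> h1 h2 h3; rewrite cellE /= !in_itv/= mulrAC. Qed.

Lemma measurable_cell P : measurable (cell P).
Proof. by rewrite cellE; apply: measurableX => //; apply: measurableX. Qed.

Lemma compact_cell P : compact (cell P).
Proof.
by rewrite cellE; apply: compact_setX; [apply: compact_setX|]; exact: segment_compact.
Qed.

Lemma forwardE : @forward R = `[0, +oo[%classic `*` setT.
Proof.
by apply/seteqP; split => [[t x]|[t x] []]; rewrite /forward /= in_itv/= andbT.
Qed.

Lemma measurable_forward : measurable (@forward R).
Proof. by rewrite forwardE; apply: measurableX. Qed.

Lemma measurable_stcell P T : measurable (stcell P T).
Proof. by apply: measurableX => //; exact: measurable_cell. Qed.

Lemma compact_stcell P T : compact (stcell P T).
Proof. by apply: compact_setX; [exact: segment_compact|exact: compact_cell]. Qed.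

Lemma stcell_forward P T : stcell P T `<=` forward.
Proof. by move=> [t x] [/= +] _; rewrite in_itv/= => /andP[]. Qed.

Lemma cell_exhaust x n : `|x.1.1| + `|x.1.2| + `|x.2| < n%:R -> cell n.*2%:R x.
Proof.
move=> xn; rewrite cellE /= !in_itv/=.
have -> : n.*2%:R / 2 = n%:R :> R by rewrite -mul2n natrM mulrAC divff ?mul1r.
have := (normr_ge0 x.1.1, normr_ge0 x.1.2, normr_ge0 x.2).
by move=> [[? ?] ?]; rewrite -!ler_norml; (split; [split|]); apply/ltW; lra.
Qed.

(** The half-space is a countable union of compact boxes. *)
Lemma measurable_st_loc (g : R -> E3 R -> R) :
  st_loc_integrable g -> measurable_fun forward (uncurry g).
Proof.
move=> lg.
have -> : @forward R = \bigcup_n stcell n.*2%:R n.*2%:R.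
  apply/seteqP; split=> [[t x] /= t0|z [n _]]; last exact: stcell_forward.
  pose M := `|t| + (`|x.1.1| + `|x.1.2| + `|x.2|).
  have := truncnS_gt M; set n := (Num.truncn M).+1 => Mn.
  have t1 := ler_norm t; have tn := normr_ge0 t.
  have x0 : 0 <= `|x.1.1| + `|x.1.2| + `|x.2| by rewrite !addr_ge0.
  exists n => //; split; last by apply: cell_exhaust; rewrite /M in Mn *; lra.
  rewrite /= in_itv/=; apply/andP; split => //; rewrite -mul2n natrM.
  by rewrite /M in Mn; lra.
apply/measurable_fun_bigcup => n; first exact: measurable_stcell.
apply/measurable_EFinP; apply: measurable_int (lg _ _ _).
- exact: compact_stcell.
- exact: stcell_forward.
Qed.

Lemma measurable_loc (g : E3 R -> R) : loc_integrable g -> measurable_fun setT g.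
Proof.
move=> lg.
have -> : [set: E3 R] = \bigcup_n cell n.*2%:R.
  apply/seteqP; split=> // x _.
  exists (Num.truncn (`|x.1.1| + `|x.1.2| + `|x.2|)).+1 => //.
  exact/cell_exhaust/truncnS_gt.
apply/measurable_fun_bigcup => n; first exact: measurable_cell.
by apply/measurable_EFinP; apply: measurable_int (lg _ _); exact: compact_cell.
Qed.

Lemma periodic_shift (A : Type) P (g : E3 R -> A) : Defs.periodic P g ->
  forall x, [/\ g (shift1 P x) = g x, g (shift2 P x) = g x & g (shift3 P x) = g x].
Proof.
have E0 (x y z a b c : R) : (x, y, z) + P *: ((a, b, c) : E3 R) = (x + P * a, y + P * b, z + P * c) by [].
move=> pg [[x y] z]; split.
- rewrite -(pg _ (inord 0)); congr g; rewrite /unit_dir inordK// E0.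
  by rewrite /= !mulr0 mulr1 !addr0 subrK.
- rewrite -(pg _ (inord 1)); congr g; rewrite /unit_dir inordK// E0.
  by rewrite /= !mulr0 mulr1 !addr0 subrK.
- rewrite -(pg _ (inord 2)); congr g; rewrite /unit_dir inordK// E0.
  by rewrite /= !mulr0 mulr1 !addr0 subrK.
Qed.

End coordinates.

(** * Test functions *)

Section test.
Context {R : realType}.
Variables P a d : R.
Hypotheses (P0 : 0 < P) (d0 : 0 < d).
Implicit Types (z v : R * E3 R) (t : R).

(** The first factor only brings the support back to a bounded set of times;
    it is 1 on a neighbourhood of the times [t >= 0]. *)
Definition time_cutoff t : R := ramp (-2) 1 t * (1 - ramp a d t).

Definition test z : R := time_cutoff z.1 *
  (cutoff P z.2.1.1 * cutoff P z.2.1.2 * cutoff P z.2.2).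

Lemma time_cutoff_Ck n : Ck n (time_cutoff : R -> R).
Proof.
apply: CkM; first exact: ramp_Ck.
by apply: CkD; [exact: Ck_cst|apply: CkN; exact: ramp_Ck].
Qed.

Lemma time_cutoffE t : 0 <= t -> time_cutoff t = 1 - ramp a d t.
Proof. by move=> t0; rewrite /time_cutoff ramp_eq1 ?mul1r//; lra. Qed.

Lemma derive_time_cutoff t : 0 <= t -> 'D_1 time_cutoff t = - 'D_1 (ramp a d) t.
Proof.
move=> t0; rewrite (@near_eq_derive _ _ R^o time_cutoff (cst 1 - (ramp a d : R -> R^o))).
  have [_ /(_ 1)[dr _]] := @ramp_Ck R 1 a d.
  by rewrite deriveB// derive_cst sub0r.
near=> s; rewrite /time_cutoff ramp_eq1 ?mul1r//.
have : -1 < s by near: s; apply: lt_nbhsr; lra.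
by lra.
Unshelve. all: end_near.
Qed.

Let lt z := z.1.
Let l1 z := z.2.1.1.
Let l2 z := z.2.1.2.
Let l3 z := z.2.2.

Let ltE (h : R) v z : lt (h *: v + z) = h * lt v + lt z. Proof. by []. Qed.
Let l1E (h : R) v z : l1 (h *: v + z) = h * l1 v + l1 z. Proof. by []. Qed.
Let l2E (h : R) v z : l2 (h *: v + z) = h * l2 v + l2 z. Proof. by []. Qed.
Let l3E (h : R) v z : l3 (h *: v + z) = h * l3 v + l3 z. Proof. by []. Qed.

Let clt : continuous lt. Proof. by move=> z; exact: cvg_fst. Qed.
Let cl1 : continuous l1.
Proof.
move=> z; apply: (@continuous_comp _ _ _ (fun z : R * E3 R => z.2) (fun x : E3 R => x.1.1)).
  exact: cvg_snd.
apply: (@continuous_comp _ _ _ (fun x : E3 R => x.1) (fun x : R * R => x.1)); exact: cvg_fst.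
Qed.
Let cl2 : continuous l2.
Proof.
move=> z; apply: (@continuous_comp _ _ _ (fun z : R * E3 R => z.2) (fun x : E3 R => x.1.2)).
  exact: cvg_snd.
apply: (@continuous_comp _ _ _ (fun x : E3 R => x.1) (fun x : R * R => x.2)).
  exact: cvg_fst.
exact: cvg_snd.
Qed.
Let cl3 : continuous l3.
Proof.
move=> z; apply: (@continuous_comp _ _ _ (fun z : R * E3 R => z.2) (fun x : E3 R => x.2)); exact: cvg_snd.
Qed.

Lemma test_Ck n : Ck n test.
Proof.
apply: CkM; first exact: (@Ck_affine _ _ n time_cutoff lt lt ltE clt (time_cutoff_Ck n)).
apply: CkM; last exact: (@Ck_affine _ _ n (cutoff P) l3 l3 l3E cl3 (cutoff_Ck P n)).
apply: CkM; first exact: (@Ck_affine _ _ n (cutoff P) l1 l1 l1E cl1 (cutoff_Ck P n)).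
exact: (@Ck_affine _ _ n (cutoff P) l2 l2 l2E cl2 (cutoff_Ck P n)).
Qed.

(** Each factor depends on one coordinate, so that the product rule applies with
    the derivatives given by [derive_affine]. *)
Lemma derive_test v z : 'D_v test z =
  v.1 * 'D_1 time_cutoff z.1 * (cutoff P z.2.1.1 * cutoff P z.2.1.2 * cutoff P z.2.2)
  + v.2.1.1 * (time_cutoff z.1 * ('D_1 (cutoff P) z.2.1.1 * cutoff P z.2.1.2 * cutoff P z.2.2))
  + v.2.1.2 * (time_cutoff z.1 * (cutoff P z.2.1.1 * 'D_1 (cutoff P) z.2.1.2 * cutoff P z.2.2))
  + v.2.2 * (time_cutoff z.1 * (cutoff P z.2.1.1 * cutoff P z.2.1.2 * 'D_1 (cutoff P) z.2.2)).
Proof.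
have scale (f : R -> R) s w : Ck 1 f -> derivable f s w /\ 'D_w f s = w * 'D_1 f s.
  move=> [_ df]; split; first by have [] := df w.
  have dfs : differentiable f s by apply/derivable1_diffP; have [] := df 1.
  by rewrite deriveE// -[w in LHS]mulr1 linearZ/= -deriveE.
have D (f : R -> R) (l : R * E3 R -> R) : Ck 1 f ->
  (forall (h : R) v z, l (h *: v + z) = h * l v + l z) ->
  is_derive z v (f \o l) (l v * 'D_1 f (l z)).
  move=> Cf lE; have [h1 h2] := derive_affine f lE v z.
  have [h3 h4] := scale _ (l z) (l v) Cf.
  by split; [exact: h1|rewrite h2].
have C1 := time_cutoff_Ck 1. have C2 := cutoff_Ck P 1.
have Dt := D _ _ C1 ltE; have D1 := D _ _ C2 l1E.
have D2 := D _ _ C2 l2E; have D3 := D _ _ C2 l3E.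
have [_ DD] := is_deriveM Dt (is_deriveM (is_deriveM D1 D2) D3).
rewrite (_ : test = (time_cutoff \o lt) * ((cutoff P \o l1) * (cutoff P \o l2) * (cutoff P \o l3)))//.
rewrite DD /GRing.scale/= /lt /l1 /l2 /l3 -!/(cutoff _ _).
rewrite -[((cutoff P \o l1) * _) z]/(cutoff P z.2.1.1 * cutoff P z.2.1.2).
rewrite -[((cutoff P \o l1) * _ * _) z]/(cutoff P z.2.1.1 * cutoff P z.2.1.2 * cutoff P z.2.2).
move: (cutoff P z.2.1.1) (cutoff P z.2.1.2) (cutoff P z.2.2)
  ('D_1 (cutoff P) z.2.1.1) ('D_1 (cutoff P) z.2.1.2) ('D_1 (cutoff P) z.2.2)
  (time_cutoff z.1) ('D_1 time_cutoff z.1) => x1 x2 x3 y1 y2 y3 t t'.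
by ring.
Qed.

Lemma test_ge0 z : 0 <= test z.
Proof.
have c0 := cutoff_ge0 P0.
have /andP[r0 _] := ramp_itv (-2) 1 z.1; have /andP[_ r1] := ramp_itv a d z.1.
rewrite /test /time_cutoff; apply: mulr_ge0; first by rewrite mulr_ge0// subr_ge0.
by apply: mulr_ge0 => //; exact: mulr_ge0.
Qed.

Lemma test_eq0 z : ~ (`[-2, a + d]%classic `*` cell (3 * P)) z -> test z = 0.
Proof.
move=> nz; have [ta|ta] := leP z.1 (a + d); last first.
  by rewrite /test /time_cutoff (@ramp_eq1 _ a) ?subrr ?mulr0 ?mul0r// ltW.
have [z2|z2] := leP z.1 (-2).
  by rewrite /test /time_cutoff (@ramp_eq0 _ (-2)) ?mul0r.
have c0 (s : R) : ~~ (- (3 / 2 * P) <= s <= 3 / 2 * P) -> cutoff P s = 0.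
  by move=> h; rewrite cutoff_eq0//; apply: contra h => /andP[h1 h2]; have := P0; lra.
have [h1|/c0 h] := boolP (- (3 / 2 * P) <= z.2.1.1 <= 3 / 2 * P); last by rewrite /test h; ring.
have [h2|/c0 h] := boolP (- (3 / 2 * P) <= z.2.1.2 <= 3 / 2 * P); last by rewrite /test h; ring.
have [h3|/c0 h] := boolP (- (3 / 2 * P) <= z.2.2 <= 3 / 2 * P); last by rewrite /test h; ring.
exfalso; apply: nz; split; first by rewrite /= in_itv/= ta ltW.
exact: cell_triple.
Qed.

Lemma test_test_function T : a + d < T -> test_function T test.
Proof.
move=> adT; split; first exact: test_Ck.
exists (`[-2, a + d]%classic `*` cell (3 * P)); split.
- by apply: compact_setX; [exact: segment_compact|exact: compact_cell].
- by move=> [t x] [/= + _]; rewrite in_itv/= => /andP[_ /le_lt_trans]; exact.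
- exact: test_eq0.
Qed.

Lemma dt_test z : 0 <= z.1 -> dt test z = - 'D_1 (ramp a d) z.1 *
  (cutoff P z.2.1.1 * cutoff P z.2.1.2 * cutoff P z.2.2).
Proof.
move=> z0; rewrite /dt derive_test /= derive_time_cutoff//.
by rewrite !mul0r !addr0 mul1r.
Qed.

Lemma sum_dx_test (F : 'rV[R]_3) z : \sum_(j < 3) F 0 j * dx j test z =
  F 0 0 * time_cutoff z.1 * ('D_1 (cutoff P) z.2.1.1 * cutoff P z.2.1.2 * cutoff P z.2.2)
  + F 0 1 * time_cutoff z.1 * (cutoff P z.2.1.1 * 'D_1 (cutoff P) z.2.1.2 * cutoff P z.2.2)
  + F 0 2%:R * time_cutoff z.1 * (cutoff P z.2.1.1 * cutoff P z.2.1.2 * 'D_1 (cutoff P) z.2.2).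
Proof.
rewrite !big_ord_recl big_ord0 /dx !derive_test /unit_dir /=.
rewrite (_ : lift ord0 ord0 = 1 :> 'I_3); last exact/val_inj.
rewrite (_ : lift ord0 (lift ord0 ord0) = 2%:R :> 'I_3); last exact/val_inj.
rewrite !(mul0r, mul1r, add0r, addr0) !mulrA.
by rewrite -?addrA.
Qed.

End test.

(** * The balance inequality on one period cell *)

Section bounded_measurable.
Context d (T : measurableType d) (R : realType).
Implicit Types h : T -> R.

(** The multipliers that preserve integrability. *)
Definition bounded_measurable h :=
  measurable_fun setT h /\ exists M, forall z, `|h z| <= M.

Lemma bounded_measurableM h1 h2 : bounded_measurable h1 -> bounded_measurable h2 ->
  bounded_measurable (fun z => h1 z * h2 z).
Proof.
move=> [m1 [M1 b1]] [m2 [M2 b2]]; split; first exact: measurable_funM.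
by exists (M1 * M2) => z; rewrite normrM ler_pM.
Qed.

Lemma bounded_measurableB h1 h2 : bounded_measurable h1 -> bounded_measurable h2 ->
  bounded_measurable (fun z => h1 z - h2 z).
Proof.
move=> [m1 [M1 b1]] [m2 [M2 b2]]; split; first exact: measurable_funB.
by exists (M1 + M2) => z; rewrite (le_trans (ler_normB _ _))// lerD.
Qed.

Lemma bounded_measurableN h : bounded_measurable h -> bounded_measurable (fun z => - h z).
Proof.
move=> [m1 [M1 b1]]; split; first exact: measurableT_comp.
by exists M1 => z; rewrite normrN.
Qed.

Lemma bounded_measurable_cst (c : R) : bounded_measurable (cst c).
Proof. by split => //; exists `|c|. Qed.

Lemma integrable_mul_bounded (mu : {measure set T -> \bar R}) D g h :
  measurable D -> bounded_measurable h -> mu.-integrable D (EFin \o g) ->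
  mu.-integrable D (EFin \o (fun z => g z * h z)).
Proof.
move=> mD [mh [M hM]] ig.
rewrite (_ : EFin \o _ = (EFin \o g) \* (EFin \o h))%E; last by apply/funext.
apply: integrableMl => //; first exact: measurable_funTS.
exists M; split; first by rewrite num_real.
by move=> x Mx z _ /=; apply: (le_trans (hM z)); exact: ltW.
Qed.

End bounded_measurable.

Lemma bounded_measurable_comp d (T : measurableType d) (R : realType) (f : R -> R) (l : T -> R) :
  measurable_fun setT l -> bounded_measurable f -> bounded_measurable (f \o l).
Proof.
move=> ml [mf [M b]]; split; first exact: measurableT_comp.
by exists M => z; exact: b.
Qed.

Section ramp_bm.
Context {R : realType}.
Implicit Types a d P : R.

Lemma bounded_measurable_ramp a d : bounded_measurable (ramp a d : R -> R).
Proof.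
split; last by exists 1 => t; have /andP[r0 r1] := ramp_itv a d t; rewrite ger0_norm.
by apply: continuous_measurable_fun; exact: (Ck_continuous (@ramp_Ck R 0 a d)).
Qed.

Lemma bounded_measurable_derive_ramp a d : bounded_measurable ('D_1 (ramp a d) : R -> R).
Proof.
split.
  apply: continuous_measurable_fun.
  by have [_ /(_ 1)[_ [+ _]]] := @ramp_Ck R 1 a d.
have [K K0 hK] := @derive_step_bound R; exists (`|d^-1| * K) => t.
by rewrite derive_ramp normrM ler_wpM2l.
Qed.

Lemma derive_ramp_eq0 a d t : 0 < d -> a + d < t -> 'D_1 (ramp a d) t = 0.
Proof.
move=> d0 adt; rewrite (@near_eq_derive _ _ R^o _ (cst 1 : R -> R^o)) ?derive_cst//.
by near=> s; rewrite ramp_eq1//; apply/ltW; near: s; exact: lt_nbhsr.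
Unshelve. all: end_near.
Qed.

Lemma bounded_measurable_cutoff P : bounded_measurable (cutoff P).
Proof. by apply: bounded_measurableB; exact: bounded_measurable_ramp. Qed.

Lemma bounded_measurable_derive_cutoff P : bounded_measurable ('D_1 (cutoff P) : R -> R).
Proof.
rewrite (_ : 'D_1 (cutoff P) = fun t => 'D_1 (ramp (- (5 / 4 * P)) (P / 2)) t -
   'D_1 (ramp (- (P / 4)) (P / 2)) t); first by apply: bounded_measurableB; exact: bounded_measurable_derive_ramp.
apply/funext => t.
have dr (a d : R) : derivable (ramp a d : R -> R^o) t 1.
  by have [_ /(_ 1)[]] := @ramp_Ck R 1 a d.
by rewrite -deriveB//.
Qed.

End ramp_bm.

Lemma uncurryE (X Y Z : Type) (g : X -> Y -> Z) :
  uncurry g = fun z => g z.1 z.2.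
Proof. by apply/funext => -[]. Qed.

Section balance.
Context {R : realType}.
Variables (P T : R).
Hypotheses (P0 : 0 < P).
Let ST := (measurableTypeR R * (measurableTypeR R * measurableTypeR R * measurableTypeR R))%type.

Let mt : measurable_fun setT (fun z : ST => z.1 : R). Proof. exact: measurable_fst. Qed.
Let m1 : measurable_fun setT (fun z : ST => z.2.1.1 : R).
Proof. by apply: measurableT_comp => //; exact: measurableT_comp. Qed.
Let m2 : measurable_fun setT (fun z : ST => z.2.1.2 : R).
Proof. by apply: measurableT_comp => //; exact: measurableT_comp. Qed.
Let m3 : measurable_fun setT (fun z : ST => z.2.2 : R).
Proof. by apply: measurableT_comp => //; exact: measurableT_comp. Qed.

Lemma integrable_zero_ext d (X : measurableType d) (mu : {measure set X -> \bar R})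
    (D K : set X) (G : X -> R) : measurable D -> measurable K -> K `<=` D ->
  (forall z, D z -> ~ K z -> G z = 0) ->
  (mu.-integrable D (EFin \o G) <-> mu.-integrable K (EFin \o G)) /\
  (\int[mu]_(z in D) (G z)%:E = \int[mu]_(z in K) (G z)%:E)%E.
Proof.
move=> mD mK KD G0.
have E : (EFin \o G) \_ D = (EFin \o G) \_ K.
  apply/funext => z; rewrite !patchE; case: ifPn; case: ifPn => //.
    by move=> /negP; rewrite inE => nK /set_mem Dz /=; rewrite G0.
  by move=> /set_mem/KD Dz /negP; rewrite inE.
split; first by rewrite [X in X <-> _]integrable_mkcond// E -integrable_mkcond.
by rewrite [LHS]integral_mkcond E -integral_mkcond.
Qed.

Let outside_wide t : ~~ (- (3 / 2 * P) <= t <= 3 / 2 * P) ->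
  ~~ (- (3 / 2 * P) <= t < P / 2).
Proof. by apply: contra => /andP[h1 h2]; have := P0; lra. Qed.

Variables (A s : R -> E3 R -> R) (F : R -> E3 R -> 'rV[R]_3) (a0 : E3 R -> R).
Hypotheses (pA : forall t, 0 <= t -> Defs.periodic P (A t))
  (ps : forall t, 0 <= t -> Defs.periodic P (s t))
  (pF : forall t, 0 <= t -> Defs.periodic P (F t))
  (pa0 : Defs.periodic P a0).
Hypothesis (bal : balance_le T A F s a0).
Variables (a d : R).
Hypotheses (a_ge0 : 0 <= a) (d0 : 0 < d) (adT : a + d < T).

(** The spatial cutoffs disappear by [integral_partition], and with them the
    flux.  The cutoff in time is 1 at [t = 0], hence the full initial value, and
    0 after [a + d < T], hence the restriction to the times up to [T]. *)
Lemma balance_test :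
  \int[stvol]_(z in stcell P T) (A z.1 z.2 * 'D_1 (ramp a d) z.1)
  <= (\int[stvol]_(z in stcell P T) (s z.1 z.2 * (1 - ramp a d z.1)))
     + \int[vol]_(x in cell P) a0 x.
Proof.
have [[lA lF ls la0] le0] := bal.
pose aa z := A z.1 z.2 * - 'D_1 (ramp a d) z.1 + s z.1 z.2 * (1 - ramp a d z.1).
pose FF (j : 'I_3) z := F z.1 z.2 0 j * (1 - ramp a d z.1).
have := le0 _ (test_test_function P0 d0 adT) (fun z _ => @test_ge0 R P a d P0 z).
rewrite /weak_action.
pose chi := cutoff P; pose dchi : R -> R := 'D_1 (cutoff P).
pose G (z : R * E3 R) := aa z * (chi z.2.1.1 * chi z.2.1.2 * chi z.2.2)
  + FF 0 z * (dchi z.2.1.1 * chi z.2.1.2 * chi z.2.2)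
  + FF 1 z * (chi z.2.1.1 * dchi z.2.1.2 * chi z.2.2)
  + FF 2%:R z * (chi z.2.1.1 * chi z.2.1.2 * dchi z.2.2).
rewrite (@eq_Rintegral _ _ _ stvol forward G); last first.
  move=> z; rewrite inE => z0; rewrite dt_test// sum_dx_test /test time_cutoffE//.
  rewrite /G /aa /FF /dchi -/chi.
  move: (A z.1 z.2) (s z.1 z.2) (F z.1 z.2 0 0) (F z.1 z.2 0 1) (F z.1 z.2 0 2%:R)
    ('D_1 (ramp a d) z.1) (ramp a d z.1) (chi z.2.1.1) (chi z.2.1.2) (chi z.2.2)
    ('D_1 chi z.2.1.1) ('D_1 chi z.2.1.2) ('D_1 chi z.2.2).
  by move=> *; ring.
have mforw := @measurable_forward R.
have mA := measurable_st_loc lA.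
have ms := measurable_st_loc ls.
have mF j := measurable_st_loc (lF j).
rewrite uncurryE in mA; rewrite uncurryE in ms.
have {}mF j : measurable_fun forward (fun z => F z.1 z.2 0 j).
  by have := mF j; rewrite uncurryE.
have bmr := bounded_measurableB (bounded_measurable_cst ST 1) (bounded_measurable_comp mt (bounded_measurable_ramp a d)).
have bmd := bounded_measurable_comp mt (bounded_measurable_derive_ramp a d).
have bc := bounded_measurable_cutoff P; have bdc := bounded_measurable_derive_cutoff P.
have maa : measurable_fun forward aa.
  apply: measurable_funD; apply: measurable_funM => //.
    exact: measurable_funTS (bounded_measurableN bmd).1.
  exact: measurable_funTS bmr.1.
have mFF j : measurable_fun forward (FF j).
  apply: measurable_funM; first exact: mF.
  exact: measurable_funTS bmr.1.
pose K : set (R * E3 R) := stcell (3 * P) (a + d).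
have chi0 t : ~~ (- (3 / 2 * P) <= t < P / 2) -> chi t = 0.
  move=> h; apply: cutoff_eq0 => //; apply: contra h => /andP[h1 h2]; have := P0; lra.
have dchi0 t : ~~ (- (3 / 2 * P) <= t < P / 2) -> dchi t = 0.
  exact: derive_cutoff_eq0.
have chi1 t : - (P / 2) <= t < P / 2 -> chi t + chi (t - P) = 1.
  by move=> h; apply: cutoff_add => //; have := P0; lra.
have dchi1 t : - (P / 2) <= t < P / 2 -> dchi t + dchi (t - P) = 0.
  exact: derive_cutoff_add.
have G0 z : forward z -> ~ K z -> G z = 0.
  move=> z0 nK; have [ta|ta] := leP z.1 (a + d); last first.
    rewrite /G /aa /FF derive_ramp_eq0// ramp_eq1//; last exact: ltW.
    by rewrite subrr oppr0 !(mulr0, mul0r, addr0).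
  have h0 t : ~~ (- (3 / 2 * P) <= t <= 3 / 2 * P) -> chi t = 0 /\ dchi t = 0.
    by move=> h; rewrite chi0 ?dchi0// outside_wide.
  have [h1|/h0 [h h']] := boolP (- (3 / 2 * P) <= z.2.1.1 <= 3 / 2 * P); last by rewrite /G h h' !(mulr0, mul0r) !addr0.
  have [h2|/h0 [h h']] := boolP (- (3 / 2 * P) <= z.2.1.2 <= 3 / 2 * P); last by rewrite /G h h' !(mulr0, mul0r) !addr0.
  have [h3|/h0 [h h']] := boolP (- (3 / 2 * P) <= z.2.2 <= 3 / 2 * P); last by rewrite /G h h' !(mulr0, mul0r) !addr0.
  exfalso; apply: nK; split; first by rewrite /= in_itv/= ta; apply/andP.
  exact: cell_triple.
have mK : measurable K by exact: measurable_stcell.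
have KF : K `<=` forward by exact: stcell_forward.
have cK : compact K by exact: compact_stcell.
have intA := lA K cK KF; rewrite uncurryE in intA.
have ints := ls K cK KF; rewrite uncurryE in ints.
have intF j := lF j K cK KF.
have {}intF j : stvol.-integrable K (EFin \o (fun z => F z.1 z.2 0 j)).
  by have := intF j; rewrite uncurryE.
have iG : stvol.-integrable forward (EFin \o G).
  apply/(integrable_zero_ext stvol mforw mK KF G0).1.
  have iprod (g : R * E3 R -> R) (c1 c2 c3 : R -> R) :
      stvol.-integrable K (EFin \o g) -> bounded_measurable c1 ->
      bounded_measurable c2 -> bounded_measurable c3 ->
      stvol.-integrable K (EFin \o (fun z => g z * (c1 z.2.1.1 * c2 z.2.1.2 * c3 z.2.2))).
    move=> ig b1 b2 b3; apply: integrable_mul_bounded => //.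
    by apply: bounded_measurableM; [apply: bounded_measurableM|]; [exact: (bounded_measurable_comp m1)|exact: (bounded_measurable_comp m2)|exact: (bounded_measurable_comp m3)].
  have iFF j : stvol.-integrable K (EFin \o FF j).
    exact: integrable_mul_bounded.
  have iaa : stvol.-integrable K (EFin \o aa).
    pose aA z := A z.1 z.2 * - 'D_1 (ramp a d) z.1.
    pose as_ z := s z.1 z.2 * (1 - ramp a d z.1).
    rewrite (_ : EFin \o aa = (EFin \o aA) \+ (EFin \o as_))%E; last exact/funext.
    apply: integrableD => //.
      by apply: integrable_mul_bounded => //; exact: (bounded_measurableN bmd).
    exact: integrable_mul_bounded.
  have iD := @integrableD _ _ _ stvol K mK.
  have := iD _ _ (iD _ _ (iD _ _ (iprod aa chi chi chi iaa bc bc bc)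
    (iprod (FF 0) dchi chi chi (iFF 0) bdc bc bc)) (iprod (FF 1) chi dchi chi (iFF 1) bc bdc bc))
    (iprod (FF 2%:R) chi chi dchi (iFF 2%:R) bc bc bdc).
  by apply: eq_integrable.
have Fs z : forward z -> [/\ (forall j, FF j (z.1, shift1 P z.2) = FF j z),
    (forall j, FF j (z.1, shift2 P z.2) = FF j z) & (forall j, FF j (z.1, shift3 P z.2) = FF j z)].
  move=> z0; have [p1 p2 p3] := periodic_shift (pF z0) z.2.
  by split => j; rewrite /FF /= ?p1 ?p2 ?p3.
have As z : forward z -> [/\ aa (z.1, shift1 P z.2) = aa z,
    aa (z.1, shift2 P z.2) = aa z & aa (z.1, shift3 P z.2) = aa z].
  move=> z0; have [p1 p2 p3] := periodic_shift (pA z0) z.2.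
  have [q1 q2 q3] := periodic_shift (ps z0) z.2.
  by split; rewrite /aa /= ?p1 ?p2 ?p3 ?q1 ?q2 ?q3.
have [mD iaa intE] := @integral_partition _ _ R stvol P
  (fun z => (z.1, shift1 P z.2)) (fun z => (z.1, shift2 P z.2)) (fun z => (z.1, shift3 P z.2))
  (fun z => z.2.1.1) (fun z => z.2.1.2) (fun z => z.2.2) forward mforw
  (preserving_st (preserving_shift1 P)) (preserving_st (preserving_shift2 P))
  (preserving_st (preserving_shift3 P)) m1 m2 m3
  (fun z => erefl) (fun z => erefl) (fun z => erefl) (fun z => erefl) (fun z => erefl)
  (fun z => erefl) (fun z => erefl) (fun z => erefl) (fun z => erefl)
  (null_st (measurable_preimT measurable_x1 (measurable_set1 (P / 2))) (null_plane1 (P / 2)))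
  (null_st (measurable_preimT measurable_x2 (measurable_set1 (P / 2))) (null_plane2 (P / 2)))
  (null_st (measurable_preimT measurable_x3 (measurable_set1 (P / 2))) (null_plane3 (P / 2)))
  (fun z => iff_refl _) (fun z => iff_refl _) (fun z => iff_refl _)
  chi dchi bc.1 bdc.1 chi0 dchi0 chi1 dchi1 aa (FF 0) (FF 1) (FF 2%:R)
  maa (mFF 1) (mFF 2%:R)
  (fun z h => let: And3 h1 _ _ := As z h in h1)
  (fun z h => let: And3 _ h1 _ := As z h in h1)
  (fun z h => let: And3 _ _ h1 := As z h in h1)
  (fun z h => let: And3 h1 _ _ := Fs z h in h1 _)
  (fun z h => let: And3 h1 _ _ := Fs z h in h1 _)
  (fun z h => let: And3 h1 _ _ := Fs z h in h1 _)
  (fun z h => let: And3 _ h1 _ := Fs z h in h1 _)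
  (fun z h => let: And3 _ h1 _ := Fs z h in h1 _)
  (fun z h => let: And3 _ _ h1 := Fs z h in h1 _) iG.
set Dc := (X in stvol.-integrable X) in mD iaa intE.
have DcE : Dc = [set z | 0 <= z.1 /\ cell P z.2].
  rewrite /Dc cellE; apply/seteqP; split => z /=; rewrite !in_itv/=.
    by move=> [[[? ?] ?] ?].
  by move=> [? [[? ?] ?]].
have sDc : stcell P T `<=` Dc.
  by move=> z [/= + ?]; rewrite DcE in_itv/= => /andP[].
have mst := @measurable_stcell R P T.
have aa0 z : Dc z -> ~ stcell P T z -> aa z = 0.
  rewrite DcE => -[z0 cz] nz.
  have zT : a + d < z.1.
    rewrite ltNge; apply/negP => h; apply: nz; split => //=.
    by rewrite in_itv/= z0/= (le_trans h)// ltW.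
  by rewrite /aa derive_ramp_eq0// ramp_eq1 ?subrr ?oppr0 ?mulr0 ?addr0// ltW.
have [_ intE2] := integrable_zero_ext stvol mD mst sDc aa0.
have -> : \int[stvol]_(x in forward) G x = \int[stvol]_(x in stcell P T) aa x.
  by rewrite /Rintegral intE intE2.
have cst_ : compact (stcell P T) by exact: compact_stcell.
have iA' := lA _ cst_ (@stcell_forward R P T); rewrite uncurryE in iA'.
have is' := ls _ cst_ (@stcell_forward R P T); rewrite uncurryE in is'.
have -> : \int[stvol]_(x in stcell P T) aa x =
   - (\int[stvol]_(z in stcell P T) (A z.1 z.2 * 'D_1 (ramp a d) z.1))
   + \int[stvol]_(z in stcell P T) (s z.1 z.2 * (1 - ramp a d z.1)).
  rewrite [RHS]addrC -RintegralB//; last 2 first.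
  - exact: integrable_mul_bounded.
  - exact: integrable_mul_bounded.
  by apply: eq_Rintegral => z _; rewrite /aa; ring.
suff -> : \int[vol]_x (a0 x * test P a d (0, x)) = \int[vol]_(x in cell P) a0 x.
  by rewrite -addrA addrC subr_ge0.
pose G' (x : E3 R) := a0 x * (chi x.1.1 * chi x.1.2 * chi x.2)
  + (fun=> 0) x * (dchi x.1.1 * chi x.1.2 * chi x.2)
  + (fun=> 0) x * (chi x.1.1 * dchi x.1.2 * chi x.2)
  + (fun=> 0) x * (chi x.1.1 * chi x.1.2 * dchi x.2).
rewrite (@eq_Rintegral _ _ _ vol setT G'); last first.
  by move=> x _; rewrite /test time_cutoffE// ramp_eq0// /G' /chi /= subr0 mul1r !mul0r !addr0.
have mc := @measurable_cell R (3 * P).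
have G0' x : setT x -> ~ cell (3 * P) x -> G' x = 0.
  move=> _ nx; have h0 t : ~~ (- (3 / 2 * P) <= t <= 3 / 2 * P) -> chi t = 0.
    by move=> h; rewrite chi0// outside_wide.
  have [h1|/h0 h] := boolP (- (3 / 2 * P) <= x.1.1 <= 3 / 2 * P); last by rewrite /G' h !(mulr0, mul0r, addr0).
  have [h2|/h0 h] := boolP (- (3 / 2 * P) <= x.1.2 <= 3 / 2 * P); last by rewrite /G' h !(mulr0, mul0r, addr0).
  have [h3|/h0 h] := boolP (- (3 / 2 * P) <= x.2 <= 3 / 2 * P); last by rewrite /G' h !(mulr0, mul0r, addr0).
  by exfalso; apply: nx; exact: cell_triple.
have iG' : vol.-integrable setT (EFin \o G').
  apply/(integrable_zero_ext vol measurableT mc (@subsetT _ _) G0').1.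
  apply: (@eq_integrable _ _ _ vol _ mc
     (EFin \o (fun x => a0 x * (chi x.1.1 * chi x.1.2 * chi x.2)))).
    by move=> x _; rewrite /G' /= !mul0r !addr0.
  apply: integrable_mul_bounded => //; last by apply: la0; exact: compact_cell.
  apply: bounded_measurableM; [apply: bounded_measurableM|].
  - exact: (bounded_measurable_comp measurable_x1).
  - exact: (bounded_measurable_comp measurable_x2).
  - exact: (bounded_measurable_comp measurable_x3).
have pa x := periodic_shift pa0 x.
have [_ _ intE'] := @integral_partition _ _ R vol P (shift1 P) (shift2 P) (shift3 P)
  (fun x => x.1.1) (fun x => x.1.2) (fun x => x.2) setT measurableT
  (preserving_shift1 P) (preserving_shift2 P) (preserving_shift3 P)
  measurable_x1 measurable_x2 measurable_x3
  (fun z => erefl) (fun z => erefl) (fun z => erefl) (fun z => erefl) (fun z => erefl)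
  (fun z => erefl) (fun z => erefl) (fun z => erefl) (fun z => erefl)
  (null_plane1 (P / 2)) (null_plane2 (P / 2)) (null_plane3 (P / 2))
  (fun z => iff_refl _) (fun z => iff_refl _) (fun z => iff_refl _)
  chi dchi bc.1 bdc.1 chi0 dchi0 chi1 dchi1 a0 (fun=> 0) (fun=> 0) (fun=> 0)
  (measurable_loc la0) (measurable_cst _) (measurable_cst _)
  (fun z _ => let: And3 h1 _ _ := pa z in h1)
  (fun z _ => let: And3 _ h1 _ := pa z in h1)
  (fun z _ => let: And3 _ _ h1 := pa z in h1)
  (fun z _ => erefl) (fun z _ => erefl) (fun z _ => erefl) (fun z _ => erefl)
  (fun z _ => erefl) (fun z _ => erefl) iG'.
rewrite /Rintegral intE'; congr (fine (integral _ _ _)).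
rewrite cellE; apply/seteqP; split => z /=; rewrite !in_itv/=.
  by move=> [[[_ ?] ?] ?].
by move=> [[? ?] ?].
Qed.

End balance.

(** * From averages in time to almost every time *)

Lemma bounded_integrable d (X : measurableType d) (R : realType)
    (mu : {measure set X -> \bar R}) D (h : X -> R) :
  measurable D -> (mu D < +oo)%E -> bounded_measurable h ->
  mu.-integrable D (EFin \o h).
Proof.
move=> mD Doo [mh [M hM]]; apply: measurable_bounded_integrable => //.
  exact: measurable_funTS.
exists M; split; first by rewrite num_real.
by move=> x Mx z _ /=; apply: (le_trans (hM z)); exact: ltW.
Qed.

Section time_localization.
Context {R : realType}.
Implicit Types (a d t T K : R).
Local Notation mu := (@leb R).

Lemma derive_ramp_eq0l a d t : 0 < d -> t < a -> 'D_1 (ramp a d) t = 0.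
Proof.
move=> d0 ta; rewrite (@near_eq_derive _ _ R^o _ (cst 0 : R -> R^o)) ?derive_cst//.
by near=> s; rewrite ramp_eq0//; apply/ltW; near: s; exact: lt_nbhsl.
Unshelve. all: end_near.
Qed.

Lemma integral_derive_ramp a d T : 0 <= a -> 0 < d -> a + d <= T ->
  \int[mu]_(t in `[0, T]) 'D_1 (ramp a d) t = 1.
Proof.
move=> a0 d0 adT.
have [cr /(_ 1)[dr [cdr _]]] := @ramp_Ck R 1 a d.
rewrite /Rintegral (@continuous_FTC2 _ _ (ramp a d)).
- by rewrite ramp_eq1// ramp_eq0//= subr0.
- by apply: lt_le_trans adT; rewrite ltr_wpDl.
- exact: continuous_subspaceT.
- by split => [t _||]; [exact: dr|apply: cvg_at_right_filter; exact: cr|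
    apply: cvg_at_left_filter; exact: cr].
- by move=> t _; rewrite derive1E.
Qed.

(** At a Lebesgue point [t] of [e], take ramps centred at [t] with width [r]
    tending to 0.  Their derivatives have integral 1 and are [O(1 / r)], so that
    the averages of [e] against them tend to [e t]. *)
Lemma ae_le_of_ramp (e : R -> R) T K : 0 < T ->
  mu.-integrable `[0, T] (EFin \o e) ->
  (forall a d, 0 <= a -> 0 < d -> a + d < T ->
    \int[mu]_(t in `[0, T]) (e t * 'D_1 (ramp a d) t) <= K) ->
  {ae mu, forall t, `[0, T]%classic t -> e t <= K}.
Proof.
move=> T0 ie eK.
pose f := e \_ `[0, T].
have mI : measurable (`[0, T]%classic : set (measurableTypeR R)) by [].
have if_ : mu.-integrable setT (EFin \o f).
  rewrite /f -restrict_EFin.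
  by have := (@integrable_mkcond _ _ _ mu _ (EFin \o e) mI).1 ie.
have lf : locally_integrable setT f by apply: open_integrable_locally => //; exact: openT.
have [L L0 hL] := @derive_step_bound R.
(* The difference [e t - K] is at most the integral of [|e t - e s| |D s|],
   where [D] is supported in the ball of radius [r] and bounded by [L / r]. *)
have key t : lebesgue_pt f t -> 0 < t < T -> e t <= K.
  move=> lt /andP[t0 tT]; apply/ler_addgt0Pr => eps eps0.
  have c0 : 0 < eps / (2 * L) by rewrite divr_gt0// mulr_gt0.
  have [r [r0 rt rT rdavg]] : exists r, [/\ 0 < r, r < t, r < T - t &
      (davg f t r < (eps / (2 * L))%:E)%E].
    have small : \forall r \near 0^'+, (davg f t r < (eps / (2 * L))%:E)%E.
      apply: (lt [set x | (x < (eps / (2 * L))%:E)%E]).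
      by apply: open_nbhs_nbhs; split; [exact: open_ereal_lt_ereal|rewrite /= lte_fin].
    near (0 : R)^'+ => r; exists r; split.
    - by near: r; exact: nbhs_right_gt.
    - by near: r; exact: nbhs_right_lt.
    - by near: r; apply: nbhs_right_lt; rewrite subr_gt0.
    - by near: r.
  have a0 : 0 <= t - r / 2 by lra.
  have adT : t - r / 2 + r < T by lra.
  pose D : R -> R := 'D_1 (ramp (t - r / 2) r).
  have bD : bounded_measurable D := bounded_measurable_derive_ramp _ _.
  have iD : mu.-integrable `[0, T] (EFin \o D).
    apply: bounded_integrable => //.
    by rewrite [X in (X < _)%E]lebesgue_measure_itv/=; case: ifP => // _; rewrite ltry.
  have ieD : mu.-integrable `[0, T] (EFin \o (fun s => e s * D s)) by exact: integrable_mul_bounded.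
  have ietD : mu.-integrable `[0, T] (EFin \o (fun s => e t * D s)).
    by apply: (@integrableZl _ _ _ mu _ mI (e t) (EFin \o D)).
  pose g s := e t * D s - e s * D s.
  have ig : mu.-integrable `[0, T] (EFin \o g).
    by rewrite (_ : EFin \o g = (EFin \o (fun s => e t * D s)%R) \-
      (EFin \o (fun s => e s * D s)%R))%E; [exact: (@integrableB _ _ _ mu _ mI)|exact/funext].
  have h1 : e t - K <= \int[mu]_(s in `[0, T]) g s.
    rewrite RintegralB// RintegralZl// integral_derive_ramp// ?mulr1; last exact: ltW.
    by rewrite lerD2l lerN2; exact: eK.
  have h2 : ((e t - K)%:E <= \int[mu]_(s in `[0%R, T]) `|(g s)%:E|)%E.
    apply: (@le_trans _ _ `|\int[mu]_(s in `[0, T]) g s|%:E).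
      by rewrite lee_fin (le_trans h1)// ler_norm.
    rewrite (EFin_normr_Rintegral mI ig).
    by apply: le_abse_integral => //; exact: measurable_int ig.
  have Bsub : ball t r `<=` `[0, T]%classic.
    move=> s; rewrite ball_itv /= !in_itv/= => /andP[? ?]; apply/andP; split; lra.
  have g0 s : `[0, T]%classic s -> ~ ball t r s -> `|g s| = 0.
    move=> _; rewrite ball_itv /= in_itv/= => /negP; rewrite negb_and -!leNgt => h.
    have Ds : D s = 0.
      move/orP : h => [h|h].
        by apply: derive_ramp_eq0l => //; lra.
      by apply: derive_ramp_eq0 => //; lra.
    by rewrite /g Ds !mulr0 subrr normr0.
  have [_ gE] := integrable_zero_ext mu mI (measurable_ball t r) Bsub g0.
  have DL s : `|D s| <= L / r.
    by rewrite /D derive_ramp normrM gtr0_norm ?invr_gt0// mulrC ler_pM2r ?invr_gt0.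
  have mf : measurable_fun setT f by apply/measurable_EFinP; exact: measurable_int if_.
  have mB : measurable (ball t r : set (measurableTypeR R)) by exact: measurable_ball.
  have fE s : `[0, T]%classic s -> f s = e s by move=> sT; rewrite /f patchE mem_set.
  have mft : measurable_fun (ball t r) (fun s => (`|f s - f t|)%:E).
    apply: measurable_funTS; apply/measurable_EFinP; apply: measurableT_comp => //.
    exact: measurable_funB.
  have h3 : (\int[mu]_(s in ball t r) `|g s|%:E <=
      (L / r)%:E * \int[mu]_(s in ball t r) `|f s - f t|%:E)%E.
    have Lr0 : (0 <= (L / r)%:E)%E by rewrite lee_fin divr_ge0// ltW.
    rewrite -ge0_integralZl//.
    apply: ge0_le_integral => //.
    - apply/measurable_EFinP; apply: measurableT_comp => //.
      apply/measurable_EFinP; apply: (measurable_funS mI) => //.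
      exact: measurable_int ig.
    - exact: measurable_funeM.
    - move=> s sB; rewrite -EFinM lee_fin.
      rewrite (fE s (Bsub s sB)) (fE t (Bsub t (ballxx t r0))).
      have -> : g s = (e t - e s) * D s by rewrite /g; ring.
      by rewrite normrM (distrC (e t)) [leRHS]mulrC ler_wpM2l.
  have dE : (\int[mu]_(s in ball t r) `|f s - f t|%:E = (r *+ 2)%:E * davg f t r)%E.
    have r20 : r *+ 2 != 0 by rewrite mulrn_eq0/= gt_eqF.
    rewrite /davg /iavg lebesgue_measure_ball ?ltW// inver (negbTE r20).
    by rewrite muleA -EFinM divff// mul1e.
  rewrite -lerBlDl -lee_fin (le_trans h2)// gE (le_trans h3)// dE.
  rewrite muleA -EFinM.
  have -> : L / r * (r *+ 2) = 2 * L by rewrite -mulr_natr; field; rewrite gt_eqF.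
  rewrite -lee_pdivlMl ?mulr_gt0// -EFinM mulrC; exact: ltW.
(* The ramps have to stay inside the time interval, whose ends are excluded. *)
have ne c : {ae mu, forall t, t != c}.
  by exists [set c]; split => //; [exact: leb_set1|move=> t /= /negP/negPn/eqP].
apply: (@filterS3 _ _ (ae_filter_ringOfSetsType mu) _ _ _ _ _
  (lebesgue_differentiation lf) (ne 0) (ne T)).
move=> t lt tn0 tnT; rewrite /= in_itv/= => /andP[t0 tT].
by apply: key => //; rewrite !lt_neqAle t0 tT tnT eq_sym tn0.
Unshelve. all: end_near.
Qed.

End time_localization.

(** * Convergence of the sum over the frequencies *)

Section one_dimensional_series.
Context {R : realType}.
Implicit Types (s sigma w : R) (n : nat).

(** A discrete counterpart of the derivative of a negative power, from
    [1 + x <= expR x]. *)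
Lemma powR_telescope sigma n : 0 < sigma ->
  sigma * n.+2%:R `^ (- (sigma + 1)) <=
  n.+1%:R `^ (- sigma) - n.+2%:R `^ (- sigma).
Proof.
move=> s0; set x : R := n.+1%:R; set y : R := n.+2%:R.
have x0 : 0 < x by rewrite ltr0n.
have y0 : 0 < y by rewrite ltr0n.
have yE : y = x + 1 by rewrite /y -natr1.
have lnxy : ln x <= ln y - y^-1.
  have -> : x = y * (1 + - y^-1).
    by rewrite mulrDr mulr1 mulrN divff ?gt_eqF// yE addrK.
  have h : -1 < - y^-1.
    by rewrite ltrN2 invf_lt1// yE ltrDr.
  have h' : 0 < 1 + - y^-1 by rewrite addrC -ltrBlDr sub0r.
  rewrite lnM ?posrE//.
  by rewrite lerD2l le_ln1Dx.
have -> : y `^ (- (sigma + 1)) = y `^ (- sigma) * y^-1.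
  by rewrite opprD powRD ?powR_inv1 ?ltW//; apply/implyP => _; rewrite gt_eqF.
have E (z : R) : 0 < z -> z `^ (- sigma) = expR (- sigma * ln z).
  by move=> z0; rewrite /powR gt_eqF.
have -> : x `^ (- sigma) = y `^ (- sigma) * expR (sigma * (ln y - ln x)).
  by rewrite !E// -expRD; congr expR; ring.
rewrite -lerBlDr opprK mulrCA -[X in _ + X]mulr1 -mulrDr ler_wpM2l ?powR_ge0//.
apply: le_trans (expR_ge1Dx _); rewrite addrC lerD2l (ler_wpM2l (ltW s0))//.
by rewrite lerBrDr addrC -lerBrDr.
Qed.

(** The terms are bounded by the differences of a convergent sequence. *)
Lemma nneseries_powR_lty sigma : 0 < sigma ->
  (\sum_(n <oo) (n.+1%:R `^ (- (sigma + 1)))%:E < +oo :> \bar R)%E.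
Proof.
move=> s0; apply: (@le_lt_trans _ _ (1 + sigma^-1)%:E); last exact: ltry.
apply: lime_le.
  by apply: is_cvg_nneseries => n _ _; rewrite lee_fin powR_ge0.
apply: nearW => N; rewrite sumEFin lee_fin.
case: N => [|N]; first by rewrite big_nil addr_ge0// invr_ge0 ltW.
suff : \sum_(0 <= n < N.+1) n.+1%:R `^ (- (sigma + 1)) <=
    1 + sigma^-1 * (1 - N.+1%:R `^ (- sigma)) :> R.
  move=> /le_trans; apply; rewrite lerD2l; apply: ler_piMr.
    by rewrite invr_ge0 ltW.
  by rewrite lerBlDr lerDl powR_ge0.
elim: N => [|N IH].
  by rewrite big_nat1 !powR1 subrr mulr0 addr0.
rewrite big_nat_recr//=; have h := powR_telescope N s0.
apply: (le_trans (lerD IH (lexx _))).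
rewrite -addrA lerD2l -lerBrDl -mulrBr.
rewrite ler_pdivlMl//; apply: le_trans h _.
by rewrite le_eqVlt; apply/orP; left; apply/eqP; ring.
Qed.

Lemma esumZ_le (I : choiceType) (D : set I) (c : R) (b : I -> \bar R) :
  0 <= c -> (forall i, (0 <= b i)%E) ->
  (\esum_(i in D) (c%:E * b i) <= c%:E * \esum_(i in D) b i)%E.
Proof.
move=> c0 b0; apply: ge_ereal_sup => _ [X [finX XD] <-].
rewrite -ge0_mule_fsumr//.
by rewrite lee_wpmul2l//; apply: ereal_sup_ubound; exists X.
Qed.

Lemma esum_subset_le (I : choiceType) (A B : set I) (b : I -> \bar R) :
  A `<=` B -> (forall i, (0 <= b i)%E) ->
  (\esum_(i in A) b i <= \esum_(i in B) b i)%E.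
Proof.
move=> AB b0; rewrite esum_mkcond [leRHS]esum_mkcond; apply: le_esum => i _.
by case: ifPn => [/set_mem/AB iB|_]; [rewrite mem_set|case: ifP].
Qed.

(** Up to a constant, [1 + w n^2] is at least the square of the index in each of
    the two enumerations [Posz] and [Negz] of the two halves of the integers. *)
Lemma esum_int_lty w s : 0 < w -> 2^-1 < s ->
  (\esum_(n in [set: int]) ((1 + w * n%:~R ^+ 2) `^ (- s))%:E < +oo :> \bar R)%E.
Proof.
move=> w0 s1; pose b (n : int) : \bar R := ((1 + w * n%:~R ^+ 2) `^ (- s))%:E.
have b0 (k : int) : (0 <= b k)%E by rewrite lee_fin powR_ge0.
have sigma0 : 0 < 2 * s - 1.
  by rewrite subr_gt0 mulrC -ltr_pdivrMr// mul1r.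
(* [m (n + 1)^2 <= 1 + w k^2] whenever [k^2] is [n^2] or [(n + 1)^2]. *)
pose m := Num.min 1 w / 2.
have m0 : 0 < m by rewrite divr_gt0// lt_min ltr01.
have bE n (k : int) : k%:~R ^+ 2 = n%:R ^+ 2 :> R \/ k%:~R ^+ 2 = n.+1%:R ^+ 2 :> R ->
    (b k <= (m `^ (- s))%:E * (n.+1%:R `^ (- (2 * s - 1 + 1)))%:E)%E.
  move=> kn; rewrite -EFinM lee_fin.
  have -> : n.+1%:R `^ (- (2 * s - 1 + 1)) = (n.+1%:R ^+ 2) `^ (- s) :> R.
    by rewrite -powR_mulrn// -powRrM; congr (_ `^ _); ring.
  have h : m * n.+1%:R ^+ 2 <= 1 + w * k%:~R ^+ 2.
    have m1 : m <= 1 / 2 by rewrite /m ler_pM2r// ge_min lexx.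
    have mw : m <= w / 2 by rewrite /m ler_pM2r// ge_min lexx orbT.
    have n0 : 0 <= n%:R :> R by [].
    case: kn => ->; rewrite -(natr1 n).
      have := sqr_ge0 (n%:R - 1 : R) => ?.
      have : m * (n%:R + 1) ^+ 2 <= m * (2 * (1 + n%:R ^+ 2)) by rewrite ler_pM2l//; lra.
      have : m * n%:R ^+ 2 <= w / 2 * n%:R ^+ 2 by rewrite ler_wpM2r// sqr_ge0.
      lra.
    have : m * (n%:R + 1) ^+ 2 <= w / 2 * (n%:R + 1) ^+ 2 by rewrite ler_wpM2r// sqr_ge0.
    have : 0 <= w * (n%:R + 1) ^+ 2 by rewrite mulr_ge0 ?sqr_ge0// ltW.
    lra.
  rewrite -powRM ?(ltW m0) ?sqr_ge0//.
  have p0 : 0 < m * n.+1%:R ^+ 2 by rewrite mulr_gt0// exprn_gt0.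
  rewrite !powRN lef_pV2 ?posrE ?powR_gt0//; last exact: lt_le_trans h.
  apply: ge0_ler_powR => //; rewrite ?nnegrE ?(ltW p0)//.
  - by apply/ltW; lra.
  - exact: le_trans (ltW p0) h.
have half (e : nat -> int) : injective e ->
    (forall n, (e n)%:~R ^+ 2 = n%:R ^+ 2 :> R \/ (e n)%:~R ^+ 2 = n.+1%:R ^+ 2 :> R) ->
    (\esum_(k in range e) b k < +oo)%E.
  move=> inje he; rewrite esum_image; last by move=> x y _ _ /inje.
  apply: (@le_lt_trans _ _ (\esum_(n in [set: nat])
    ((m `^ (- s))%:E * (n.+1%:R `^ (- (2 * s - 1 + 1)))%:E))%E).
    by apply: le_esum => n _; exact: bE.
  apply: le_lt_trans (esumZ_le _ _ _) _; first exact: powR_ge0.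
    by move=> n; rewrite lee_fin powR_ge0.
  rewrite -nneseries_esumT; last by move=> n; rewrite lee_fin powR_ge0.
  by rewrite lte_mul_pinfty ?lee_fin ?powR_ge0//; exact: nneseries_powR_lty.
suff : (\esum_(k in [set: int]) b k < +oo)%E by [].
rewrite (esumID (range Posz)) => [|k _]; last exact: b0.
apply: lte_add_pinfty.
  apply: le_lt_trans (half Posz _ _).
  - by apply: esum_subset_le => // k [].
  - by move=> ? ? [].
  - by move=> n; left.
apply: le_lt_trans (half Negz _ _).
- apply: esum_subset_le => // k [_ nk]; case: k nk => k nk; last by exists k.
  by exfalso; apply: nk; exists k.
- by move=> ? ? [].
- by move=> n; right; rewrite NegzE mulrNz sqrrN.
Qed.

End one_dimensional_series.

Section lattice_series.
Context {R : realType}.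

Lemma vnorm_sq n (v : 'rV[R]_n) : vnorm v ^+ 2 = \sum_(i < n) v 0 i ^+ 2.
Proof.
rewrite /vnorm sqr_sqrtr /vdot; last by apply: sumr_ge0 => i _; rewrite -expr2 sqr_ge0.
by apply: eq_bigr => i _; rewrite expr2.
Qed.

(** Each one-dimensional expression [1 + w k_j^2] is at most [1 + |freq k|^2], so
    that a third of the exponent can be given to each of the three coordinates:
    the lattice sum is at most the cube of a sum over the integers. *)
Lemma esum_freq_lty (P s : R) : 0 < P -> 3 / 2 < s ->
  (\esum_(k in [set: 'rV[int]_3])
    ((1 + vnorm (freq P k) ^+ 2) `^ (- s))%:E < +oo :> \bar R)%E.
Proof.
move=> P0 s0.
pose w : R := (2 * pi / P) ^+ 2.
have w0 : 0 < w by rewrite exprn_gt0// divr_gt0// mulr_gt0// pi_gt0.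
pose c (n : int) : R := (1 + w * n%:~R ^+ 2) `^ (- (s / 3)).
have c0 n : 0 <= c n by exact: powR_ge0.
have c0' n : (0 <= (c n)%:E)%E by rewrite lee_fin.
pose e (k : 'rV[int]_3) : (int * (int * int))%type := (k 0 0, (k 0 1, k 0 2%:R)).
have inje : injective e.
  move=> k l [h0 h1 h2]; apply/rowP => -[[|[|[|//]]] i].
  - by rewrite (_ : Ordinal i = 0)//; exact/val_inj.
  - by rewrite (_ : Ordinal i = 1)//; exact/val_inj.
  - by rewrite (_ : Ordinal i = 2%:R)//; exact/val_inj.
pose a (x : int * (int * int)) : \bar R := ((c x.1)%:E * ((c x.2.1)%:E * (c x.2.2)%:E))%E.
have a0 x : (0 <= a x)%E by rewrite !mule_ge0.
apply: (@le_lt_trans _ _ (\esum_(k in [set: 'rV[int]_3]) a (e k))%E).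
  apply: le_esum => k _; rewrite /a /e /= -!EFinM lee_fin vnorm_sq.
  rewrite !big_ord_recl big_ord0 addr0.
  rewrite (_ : lift ord0 ord0 = 1 :> 'I_3); last exact/val_inj.
  rewrite (_ : lift ord0 (lift ord0 ord0) = 2%:R :> 'I_3); last exact/val_inj.
  rewrite !mxE -!/w.
  have E (n : int) : (2 * pi / P * n%:~R) ^+ 2 = w * n%:~R ^+ 2 :> R by rewrite exprMn.
  rewrite !E.
  set x := w * _; set y := w * _; set z := w * _.
  have x0 : 0 <= x by rewrite mulr_ge0 ?sqr_ge0// ltW.
  have y0 : 0 <= y by rewrite mulr_ge0 ?sqr_ge0// ltW.
  have z0 : 0 <= z by rewrite mulr_ge0 ?sqr_ge0// ltW.
  have mono (u v : R) : 0 < u -> u <= v -> v `^ (- (s / 3)) <= u `^ (- (s / 3)).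
    move=> u0 uv; rewrite !powRN lef_pV2 ?posrE ?powR_gt0//; last exact: lt_le_trans uv.
    by apply: ge0_ler_powR => //; rewrite ?nnegrE; lra.
  have pos : (1 + (x + (y + z)) == 0) = false by apply/negbTE; rewrite gt_eqF//; lra.
  have -> : (1 + (x + (y + z))) `^ (- s) = (1 + (x + (y + z))) `^ (- (s / 3)) *
      ((1 + (x + (y + z))) `^ (- (s / 3)) * (1 + (x + (y + z))) `^ (- (s / 3))).
    by rewrite -!powRD ?pos ?implybT//; congr (_ `^ _); field.
  rewrite /c -/x -/y -/z; apply: ler_pM; rewrite ?mulr_ge0 ?powR_ge0//.
    by apply: mono; lra.
  by apply: ler_pM; rewrite ?powR_ge0//; apply: mono; lra.
have [s1 [s1E s10]] : exists s1 : R,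
    (\esum_(n in [set: int]) (c n)%:E = s1%:E)%E /\ 0 <= s1.
  have h : (\esum_(n in [set: int]) (c n)%:E < +oo)%E by apply: esum_int_lty => //; lra.
  have h0 : (0 <= \esum_(n in [set: int]) (c n)%:E)%E by exact: esum_ge0.
  exists (fine (\esum_(n in [set: int]) (c n)%:E)%E).
  by rewrite fineK ?ge0_fin_numE//; split => //; exact: fine_ge0.
rewrite -(@esum_image _ _ _ setT e a) => [|x y _ _]; last exact: inje.
apply: (le_lt_trans (esum_subset_le (@subsetT _ _) a0)).
have pairT (I J : Type) : [set: I * J] = [set: I] `*`` (fun=> [set: J]) by apply/seteqP; split.
rewrite pairT /a -(@esum_esum _ _ _ _ _
  (fun i j => (c i)%:E * ((c j.1)%:E * (c j.2)%:E))%E); last first.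
  by move=> i j _ _; rewrite !mule_ge0.
apply: (@le_lt_trans _ _ (\esum_(i in [set: int]) (s1 * s1)%:E * (c i)%:E)%E); last first.
  apply: le_lt_trans (esumZ_le _ _ _) _; rewrite ?mulr_ge0//.
  by rewrite s1E -EFinM ltry.
apply: le_esum => i _; rewrite [leRHS]muleC.
apply: le_trans (esumZ_le _ (c0 i) _) _; first by move=> j; rewrite mule_ge0.
rewrite lee_wpmul2l// pairT -(@esum_esum _ _ _ _ _ (fun i j => (c i)%:E * (c j)%:E)%E); last first.
  by move=> j k _ _; rewrite mule_ge0.
apply: (@le_trans _ _ (\esum_(i in [set: int]) s1%:E * (c i)%:E)%E).
  apply: le_esum => j _; rewrite [leRHS]muleC.
  by apply: le_trans (esumZ_le _ (c0 j) _) _ => //; rewrite s1E.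
by apply: le_trans (esumZ_le _ s10 _) _ => //; rewrite s1E.
Qed.

End lattice_series.

(** * Interchange of sums and integrals *)

Section countable_interchange.
Context {R : realType}.

(** The series over the codes, to which monotone convergence applies. *)
Lemma esum_pickle (I : countType) (a : I -> \bar R) : (forall i, (0 <= a i)%E) ->
  (\esum_(i in [set: I]) a i =
   \sum_(n <oo) (if pickle_inv n is Some i then a i else 0))%E.
Proof.
move=> a0; pose b (n : nat) : \bar R := if @pickle_inv I n is Some i then a i else 0%E.
have b0 n : (0 <= b n)%E by rewrite /b; case: pickle_inv.
rewrite -/b nneseries_esumT//.
rewrite (_ : \esum_(i in [set: nat]) b i = \esum_(n in range (@pickle I)) b n)%E; last first.
  rewrite [RHS]esum_mkcond; apply: eq_esum => n _.
  case: ifPn => // /negP nr; rewrite /b; case E: (pickle_inv n) => [i|//].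
  exfalso; apply: nr; rewrite inE; exists i => //.
  by have := @pickle_invK I n; rewrite E.
rewrite esum_image; last by move=> x y _ _; exact: (pcan_inj (@pickleK I)).
by apply: eq_esum => i _; rewrite /b pickleK_inv.
Qed.

Lemma integral_esum d (T : measurableType d) (mu : {measure set T -> \bar R})
    (D : set T) (I : countType) (f : I -> T -> \bar R) : measurable D ->
  (forall i, measurable_fun D (f i)) -> (forall i x, (0 <= f i x)%E) ->
  (\int[mu]_(x in D) (\esum_(i in [set: I]) f i x) =
   \esum_(i in [set: I]) \int[mu]_(x in D) f i x)%E.
Proof.
move=> mD mf f0.
rewrite [RHS]esum_pickle; last by move=> i; apply: integral_ge0.
under eq_integral do rewrite esum_pickle//.
rewrite integral_nneseries//.
- apply: eq_eseriesr => n _; case: (pickle_inv n) => [i//|].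
  by rewrite integral0.
- by move=> n; case: (pickle_inv n) => [i|]; [exact: mf|exact: measurable_cst].
- by move=> n x _; case: (pickle_inv n).
Qed.

End countable_interchange.

Section product_domain.
Context d1 d2 (T1 : measurableType d1) (T2 : measurableType d2) (R : realType).
Variables (m1 : {sigma_finite_measure set T1 -> \bar R})
  (m2 : {sigma_finite_measure set T2 -> \bar R}).
Variables (A : set T1) (B : set T2).
Hypotheses (mA : measurable A) (mB : measurable B).
Local Notation m12 := (m1 \x m2)%E.

Let mAB : measurable (A `*` B). Proof. exact: measurableX. Qed.

Let patchX (g : T1 * T2 -> \bar R) x : A x ->
  (fun y => (g \_ (A `*` B)) (x, y)) = (fun y => g (x, y)) \_ B.
Proof.
move=> Ax; apply/funext => y; rewrite !patchE.
case: ifPn => [/set_mem [_ By]|/negP nB]; first by rewrite mem_set.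
by case: ifPn => // /set_mem By; exfalso; apply: nB; rewrite inE.
Qed.

Let patchN (g : T1 * T2 -> \bar R) x : ~ A x ->
  (fun y => (g \_ (A `*` B)) (x, y)) = cst 0%E.
Proof.
by move=> nA; apply/funext => y; rewrite patchE; case: ifPn => // /set_mem [/nA].
Qed.

Lemma measurable_section_integral_ge0 (g : T1 * T2 -> \bar R) :
  measurable_fun (A `*` B) g -> (forall z, (0 <= g z)%E) ->
  measurable_fun A (fun x => \int[m2]_(y in B) g (x, y))%E.
Proof.
move=> mg g0; pose G := g \_ (A `*` B).
have mG : measurable_fun setT G by exact/(measurable_restrictT _ mAB).
have G0 z : (0 <= G z)%E by rewrite /G patchE; case: ifP.
have := measurable_fun_fubini_tonelli_F (m2 := m2) G mG G0.
move=> /(measurable_funS measurableT (@subsetT _ A)).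
apply: eq_measurable_fun => x /set_mem Ax.
by rewrite /fubini_F [RHS]integral_mkcond -patchX.
Qed.

Lemma measurable_section_Rintegral (g : T1 * T2 -> R) :
  measurable_fun (A `*` B) g ->
  measurable_fun A (fun x => \int[m2]_(y in B) g (x, y)).
Proof.
move=> mg; have mg' : measurable_fun (A `*` B) (EFin \o g) by exact/measurable_EFinP.
apply: measurableT_comp => //.
rewrite (_ : (fun x => _) = (fun x => \int[m2]_(y in B) (EFin \o g)^\+ (x, y)) \-
   (fun x => \int[m2]_(y in B) (EFin \o g)^\- (x, y)))%E; last first.
  apply/funext => x; rewrite [LHS]integralE /=.
  by congr (_ - _)%E; apply: eq_integral => y _; rewrite ?funeposE ?funenegE.
apply: emeasurable_funB; apply: measurable_section_integral_ge0 => //.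
- exact: measurable_funepos.
- exact: measurable_funeneg.
Qed.

Lemma tonelli_prod (g : T1 * T2 -> \bar R) :
  measurable_fun (A `*` B) g -> (forall z, (0 <= g z)%E) ->
  (\int[m12]_(z in A `*` B) g z = \int[m1]_(x in A) (\int[m2]_(y in B) g (x, y)))%E.
Proof.
move=> mg g0; pose G := g \_ (A `*` B).
have mG : measurable_fun setT G by exact/(measurable_restrictT _ mAB).
have G0 z : (0 <= G z)%E by rewrite /G patchE; case: ifP.
rewrite integral_mkcond -/G fubini_tonelli1// [RHS]integral_mkcond.
apply: eq_integral => x _; rewrite /fubini_F patchE; case: ifPn => [/set_mem Ax|/negP nA].
  by rewrite [RHS]integral_mkcond -patchX.
by rewrite (_ : (fun y => _) = cst 0%E) ?integral0// patchN// => Ax; apply: nA; rewrite inE.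
Qed.

Lemma fubini_prod (g : T1 * T2 -> R) : m12.-integrable (A `*` B) (EFin \o g) ->
  [/\ {ae m1, forall x, A x -> m2.-integrable B (EFin \o (fun y => g (x, y)))},
    m1.-integrable A (EFin \o (fun x => \int[m2]_(y in B) g (x, y))) &
    \int[m12]_(z in A `*` B) g z = \int[m1]_(x in A) (\int[m2]_(y in B) g (x, y))].
Proof.
move=> ig; pose G := (EFin \o g) \_ (A `*` B).
have iG : m12.-integrable setT G by exact/(integrable_mkcond _ mAB).
have mg : measurable_fun (A `*` B) g by apply/measurable_EFinP; exact: measurable_int ig.
have aeI : {ae m1, forall x, A x -> m2.-integrable B (EFin \o (fun y => g (x, y)))}.
  apply: filterS (ae_integrable1 iG) => x + Ax.
  by rewrite patchX// => h; exact/(integrable_mkcond _ mB).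
pose F := fubini_F m2 G.
have iF : m1.-integrable A F.
  by apply: integrableS (integrable_fubini_F iG) => //.
have aeF : ae_eq m1 A F (EFin \o (fun x => \int[m2]_(y in B) g (x, y))).
  apply: filterS aeI => x h Ax; rewrite /F /fubini_F /= /Rintegral fineK.
    by rewrite [RHS]integral_mkcond (patchX (EFin \o g) Ax).
  by apply: integrable_fin_num => //; exact: h.
have mF : measurable_fun A F by exact: measurable_int iF.
have mR : measurable_fun A (EFin \o (fun x => \int[m2]_(y in B) g (x, y))).
  exact/measurable_EFinP/measurable_section_Rintegral.
have iR : m1.-integrable A (EFin \o (fun x => \int[m2]_(y in B) g (x, y))).
  apply/integrableP; split => //.
  have [_] := (integrableP _ _ _ iF); congr (_ < _)%E; apply: ae_eq_integral => //.
  - exact: measurableT_comp.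
  - exact: measurableT_comp.
  - by apply: filterS aeF => x h Ax; rewrite h.
split => //.
rewrite /Rintegral integral_mkcond -/G -integral12_prod_meas1//; congr fine.
transitivity (\int[m1]_(x in A) F x)%E; last exact: ae_eq_integral.
rewrite [RHS]integral_mkcond.
apply: eq_integral => x _; rewrite patchE; case: ifPn => // /negP nA.
rewrite /fubini_F (_ : (fun y => _) = cst 0%E) ?integral0// patchN// => Ax; apply: nA.
by rewrite inE.
Qed.

End product_domain.

(** * Pointwise bounds by the energy density *)

Section pointwise.
Context {R : realType}.
Variables kappa gamma : R.
Hypotheses (kappa0 : 0 < kappa) (gamma1 : 1 < gamma).
Implicit Types (rho : R) (u v : 'rV[R]_3).

Lemma vnorm_ge0 n (v : 'rV[R]_n) : 0 <= vnorm v.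
Proof. exact: sqrtr_ge0. Qed.

Lemma vdot_ge0 n (v : 'rV[R]_n) : 0 <= vdot v v.
Proof. by apply: sumr_ge0 => i _; rewrite -expr2 sqr_ge0. Qed.

Lemma vnormZ_sq n (a : R) (v : 'rV[R]_n) : vnorm (a *: v) ^+ 2 = a ^+ 2 * vnorm v ^+ 2.
Proof.
rewrite /vnorm !sqr_sqrtr ?vdot_ge0// /vdot mulr_sumr; apply: eq_bigr => i _.
by rewrite !mxE; ring.
Qed.

Lemma vnormZ n (a : R) (v : 'rV[R]_n) : 0 <= a -> vnorm (a *: v) = a * vnorm v.
Proof.
move=> a0; apply/eqP; rewrite -(@eqrXn2 _ 2)// ?mulr_ge0 ?vnorm_ge0//.
by rewrite vnormZ_sq exprMn.
Qed.

Lemma vdot_le u v : vdot u v <= vnorm u * vnorm v.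
Proof.
have E (w x : 'rV[R]_3) : vdot w x = w 0 0 * x 0 0 + w 0 1 * x 0 1 + w 0 2%:R * x 0 2%:R.
  rewrite /vdot !big_ord_recl big_ord0 addr0 addrA.
  rewrite (_ : lift ord0 ord0 = 1 :> 'I_3); last exact/val_inj.
  by rewrite (_ : lift ord0 (lift ord0 ord0) = 2%:R :> 'I_3); last exact/val_inj.
rewrite -sqrtrM ?vdot_ge0//; apply: le_trans (ler_norm _) _.
rewrite -sqrtr_sqr ler_wsqrtr// !E.
set a := u 0 0; set b := u 0 1; set c := u 0 2%:R.
set x := v 0 0; set y := v 0 1; set z := v 0 2%:R.
rewrite -subr_ge0 (_ : _ - _ = (a * y - b * x) ^+ 2 + (a * z - c * x) ^+ 2
  + (b * z - c * y) ^+ 2); last by ring.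
by rewrite !addr_ge0 ?sqr_ge0.
Qed.

Let gm1 : 0 < gamma - 1. Proof. by rewrite subr_gt0. Qed.

Lemma energy_ge0 rho u : 0 <= energy kappa gamma rho u.
Proof.
by rewrite /energy addr_ge0// mulr_ge0 ?sqr_ge0// invr_ge0// ltW.
Qed.

(** An expression without division, which covers the vacuum. *)
Lemma sqrt_sound rho :
  Num.sqrt rho * sound kappa gamma rho = Num.sqrt (kappa * (Num.max rho 0) `^ gamma).
Proof.
have [r0|r0] := leP rho 0.
  by rewrite ler0_sqrtr// mul0r powR0 ?mulr0 ?sqrtr0// gt_eqF// (lt_trans ltr01).
rewrite /sound -sqrtrM ?(ltW r0)// /pressure mulrC divfK//.
by rewrite gt_eqF.
Qed.

Lemma sqrt_sound_sq rho :
  (Num.sqrt rho * sound kappa gamma rho) ^+ 2 = kappa * (Num.max rho 0) `^ gamma.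
Proof. by rewrite sqrt_sound sqr_sqrtr// mulr_ge0 ?powR_ge0// ltW. Qed.

Lemma energyE rho u : energy kappa gamma rho u =
  2^-1 * (Num.max rho 0 * vnorm u ^+ 2)
  + (gamma - 1)^-1 * (kappa * (Num.max rho 0) `^ gamma).
Proof.
rewrite /energy sqrt_sound_sq vnormZ_sq; congr (_ * (_ * _) + _).
by have [r0|r0] := leP rho 0; [rewrite ler0_sqrtr// expr0n|rewrite sqr_sqrtr// ltW].
Qed.

Lemma state_sq_le rho u i :
  state kappa gamma rho u 0 i ^+ 2 <= (gamma + 1) * energy kappa gamma rho u.
Proof.
have v0 : 0 <= vnorm (Num.sqrt rho *: u) ^+ 2 by rewrite sqr_ge0.
rewrite /energy /state; set z := (Num.sqrt rho * _) ^+ 2.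
pose w := (gamma - 1)^-1 * z; rewrite -/w.
have w0 : 0 <= w by rewrite mulr_ge0 ?sqr_ge0// invr_ge0 ltW.
have h1 : 0 <= (gamma - 1) * vnorm (Num.sqrt rho *: u) ^+ 2 by rewrite mulr_ge0// ltW.
have h2 : 0 <= (gamma - 1) * w by rewrite mulr_ge0// ltW.
case: (split_ordP i) => j ->; rewrite ?row_mxEl ?row_mxEr.
  apply: (@le_trans _ _ (vnorm (Num.sqrt rho *: u) ^+ 2)).
    rewrite vnorm_sq (bigD1 j)//= lerDl.
    by apply: sumr_ge0 => l _; rewrite sqr_ge0.
  by move: v0 w0 h1 h2; lra.
rewrite [j]ord1 !mxE eqxx mulr1n -/z.
have -> : z = (gamma - 1) * w by rewrite /w mulVKf// gt_eqF.
by move: v0 w0 h1 h2; lra.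
Qed.

(** The constant [A] such that [rho^gamma + rho |u|^2] is at most [A] times the
    energy density. *)
Definition energy_const : R := (gamma - 1) / kappa + 2.

Lemma energy_const_gt0 : 0 < energy_const.
Proof. by rewrite addr_gt0// divr_gt0. Qed.

(** With [X = rho^gamma] and [Y = rho |u|^2], the left-hand side is a weighted
    geometric mean of [X] and [Y], hence at most [X + Y]. *)
Lemma momentum_powR_le rho u :
  (Num.max rho 0 * vnorm u) `^ (2 * gamma / (gamma + 1)) <=
  energy_const * energy kappa gamma rho u.
Proof.
rewrite energyE; set r := Num.max rho 0.
have r0 : 0 <= r by rewrite le_max lexx orbT.
set n := vnorm u; have n0 : 0 <= n by exact: vnorm_ge0.
pose X := r `^ gamma; pose Y := r * n ^+ 2.
have X0 : 0 <= X by exact: powR_ge0.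
have Y0 : 0 <= Y by rewrite mulr_ge0// sqr_ge0.
have gamma0 : 0 < gamma by exact: lt_trans gamma1.
have g1 : gamma + 1 != 0 by rewrite gt_eqF// addr_gt0.
pose a := (gamma + 1)^-1; pose b := gamma / (gamma + 1).
have ab : a + b = 1 by rewrite /a /b; field.
have a0 : 0 <= a by rewrite invr_ge0 ltW// addr_gt0.
have b0 : 0 <= b by rewrite divr_ge0// ltW// addr_gt0.
have -> : (r * n) `^ (2 * gamma / (gamma + 1)) = X `^ a * Y `^ b.
  rewrite /Y (powRM _ r0 (sqr_ge0 _)) /X -powRrM mulrA -powRD; last first.
    by rewrite gt_eqF// ltr_pwDl// mulr_gt0// invr_gt0 addr_gt0.
  rewrite (powRM _ r0 n0) -(powR_mulrn 2 n0) -powRrM.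
  by congr (_ `^ _ * _ `^ _); rewrite /a /b; field.
apply: (@le_trans _ _ (X + Y)).
  have XY0 : 0 <= X + Y by rewrite addr_ge0.
  apply: (@le_trans _ _ ((X + Y) `^ a * (X + Y) `^ b)).
    by apply: ler_pM; rewrite ?powR_ge0//; apply: ge0_ler_powR; rewrite ?nnegrE ?lerDl ?lerDr.
  by rewrite -powRD ab ?powRr1// oner_eq0.
rewrite -/X -/Y /energy_const.
have k0 : kappa != 0 by rewrite gt_eqF.
have g0 : gamma - 1 != 0 by rewrite gt_eqF.
have -> : ((gamma - 1) / kappa + 2) * (2^-1 * Y + (gamma - 1)^-1 * (kappa * X)) =
   X + Y + ((gamma - 1) / kappa / 2 * Y + 2 * (kappa / (gamma - 1)) * X).
  by field; rewrite k0 g0.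
rewrite lerDl; apply: addr_ge0; apply: mulr_ge0 => //.
  by rewrite !divr_ge0// ltW.
by rewrite mulr_ge0// divr_ge0// ltW.
Qed.

End pointwise.

Section fixpoint.
Context {R : realType}.

(** If [S > 1] then [S <= (E + c) S^theta]; divide by [S^theta]. *)
Lemma sublinear_bound (S E c theta : R) : 0 <= E -> 0 <= c ->
  0 < theta < 1 -> S <= E + c * S `^ theta ->
  S <= 1 + (E + c) `^ (1 - theta)^-1.
Proof.
move=> E0 c0 /andP[t0 t1] SE.
have [S1|S1] := leP S 1; first by rewrite (le_trans S1)// lerDl powR_ge0.
have S0 : 0 < S by rewrite (lt_trans _ S1).
apply: (@le_trans _ _ ((E + c) `^ (1 - theta)^-1)); last by rewrite lerDr.
have th0 : 1 - theta != 0 by rewrite gt_eqF// subr_gt0.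
have p1 : 1 <= S `^ theta.
  by rewrite -(powRr0 S); apply: ler_powR; apply/ltW.
have h : S <= (E + c) * S `^ theta.
  by apply: (le_trans SE); rewrite mulrDl lerD2r ler_peMr.
have h2 : S `^ (1 - theta) <= E + c.
  rewrite powRB; last by apply/implyP => _; rewrite gt_eqF.
  by rewrite (powRr1 (ltW S0)) ler_pdivrMr// powR_gt0.
have -> : S = (S `^ (1 - theta)) `^ (1 - theta)^-1.
  by rewrite -powRrM mulfV// powRr1// ltW.
apply: ge0_ler_powR => //.
- by rewrite invr_ge0 subr_ge0 ltW.
- by rewrite nnegrE powR_ge0.
- by rewrite nnegrE addr_ge0.
Qed.

End fixpoint.

(** * The work of the force *)

Lemma measurable_slice d1 d2 d3 (T1 : measurableType d1) (T2 : measurableType d2)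
    (T3 : measurableType d3) (A : set T1) (B : set T2) (g : T1 * T2 -> T3) x :
  measurable A -> measurable B -> measurable_fun (A `*` B) g -> A x ->
  measurable_fun B (fun y => g (x, y)).
Proof.
move=> mA mB mg Ax.
apply: (measurable_comp (measurableX mA mB) _ mg); first by move=> _ [y By <-].
exact: measurable_funTS.
Qed.

Section cell_norms.
Context {R : realType}.
Variables (P T : R).
Implicit Types (g h : E3 R -> R) (p q : R).

Lemma patch_cell g : patch (cst 0%E) (cell P) (EFin \o g) = EFin \o (g \_ (cell P)).
Proof. by apply/funext => x; rewrite /= !patchE; case: ifP. Qed.

Lemma Lx_normE q g : q != 0 -> Lx_norm P q%:E g =
  ((\int[vol]_(x in cell P) (`|g x| `^ q)%:E) `^ q^-1)%E.
Proof.
move=> q0; rewrite /Lx_norm unlock [in RHS]integral_mkcond; congr (_ `^ _)%E.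
apply: eq_integral => x _; rewrite !patchE; case: ifP => _ //=.
by rewrite normr0 powR0.
Qed.

Lemma hoelder_cell p q g h : measurable_fun (cell P) g -> measurable_fun (cell P) h ->
  0 < p -> 0 < q -> p^-1 + q^-1 = 1 ->
  (\int[vol]_(x in cell P) (`|g x * h x|)%:E <= Lx_norm P p%:E g * Lx_norm P q%:E h)%E.
Proof.
move=> mg mh p0 q0 pq; rewrite /Lx_norm !patch_cell.
have mc := @measurable_cell R P.
have mg' : measurable_fun setT (g \_ (cell P)) by exact/(measurable_restrictT _ mc).
have mh' : measurable_fun setT (h \_ (cell P)) by exact/(measurable_restrictT _ mc).
apply: le_trans (hoelder vol mg' mh' p0 q0 pq).
rewrite Lnorm1 [leLHS]integral_mkcond le_eqVlt; apply/orP; left; apply/eqP.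
apply: eq_integral => x _; rewrite /= !patchE; case: ifP => //= _.
by rewrite mul0r normr0.
Qed.

Lemma Lx_norm_ge0 (p : \bar R) g : (0 <= Lx_norm P p g)%E.
Proof. exact: Lnorm_ge0. Qed.

Lemma LtLx_norm1 (p : \bar R) (g : R -> E3 R -> R) :
  LtLx_norm P T 1%:E p g = (\int[leb]_(t in `[0%R, T]) Lx_norm P p (g t))%E.
Proof.
rewrite /LtLx_norm Lnorm1 [RHS]integral_mkcond; apply: eq_integral => t _.
by rewrite !patchE; case: ifP => _ /=; rewrite ?normr0// gee0_abs// Lx_norm_ge0.
Qed.

Lemma measurable_stcell_forward d (X : measurableType d) (g : R * E3 R -> X) :
  measurable_fun forward g -> measurable_fun (stcell P T) g.
Proof.
by apply: measurable_funS; [exact: measurable_forward|exact: stcell_forward].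
Qed.

Lemma measurable_vnorm n d (X : measurableType d) (D : set X) (v : X -> 'rV[R]_n) :
  (forall i, measurable_fun D (fun x => v x 0 i)) ->
  measurable_fun D (fun x => vnorm (v x)).
Proof.
move=> mv; rewrite /vnorm.
have ms : measurable_fun setT (@Num.sqrt R).
  by apply: continuous_measurable_fun; exact: sqrt_continuous.
apply: (measurableT_comp ms); rewrite /vdot.
by apply: measurable_sum => i; exact: measurable_funM.
Qed.

End cell_norms.

Section work_of_the_force.
Context {R : realType}.
Variables (P T kappa gamma : R).
Hypotheses (P0 : 0 < P) (kappa0 : 0 < kappa) (gamma1 : 1 < gamma).
Variables (rho : R -> E3 R -> R) (u f : R -> E3 R -> 'rV[R]_3).
Hypotheses (mrho : measurable_fun forward (uncurry rho))
  (mu_ : forall i, measurable_fun forward (uncurry (fun t x => u t x 0 i)))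
  (mf : forall i, measurable_fun forward (uncurry (fun t x => f t x 0 i))).

(** The positive part of the density makes the bounds by the energy valid at
    every point, although the density is nonnegative only almost everywhere. *)
Definition force_power (z : R * E3 R) : R :=
  Num.max (rho z.1 z.2) 0 * vnorm (u z.1 z.2) * vnorm (f z.1 z.2).

Lemma measurable_momentum : measurable_fun (stcell P T)
  (fun z => Num.max (rho z.1 z.2) 0 * vnorm (u z.1 z.2)).
Proof.
apply: measurable_funM.
  apply: measurable_maxr => //.
  by have := @measurable_stcell_forward R P T _ _ _ mrho; rewrite uncurryE.
apply: measurable_vnorm => i.
by have := @measurable_stcell_forward R P T _ _ _ (mu_ i); rewrite uncurryE.
Qed.

Lemma measurable_force : measurable_fun (stcell P T) (fun z => vnorm (f z.1 z.2)).
Proof.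
apply: measurable_vnorm => i.
by have := @measurable_stcell_forward R P T _ _ _ (mf i); rewrite uncurryE.
Qed.

Lemma force_power_ge0 z : 0 <= force_power z.
Proof. by rewrite !mulr_ge0 ?vnorm_ge0// le_max lexx orbT. Qed.

(** Hoelder's inequality in space with the exponents of the momentum and of the
    force, the former norm being controlled by a power of the energy. *)
Lemma force_power_le (S : R) : 0 <= S ->
  {ae leb, forall t, `[0, T]%classic t ->
    vol.-integrable (cell P) (EFin \o (fun x => energy kappa gamma (rho t x) (u t x))) /\
    \int[vol]_(x in cell P) energy kappa gamma (rho t x) (u t x) <= S} ->
  (\int[stvol]_(z in stcell P T) (force_power z)%:E <=
   ((energy_const kappa gamma * S) `^ ((gamma + 1) / (2 * gamma)))%:E
     * force_norm P gamma T f)%E.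
Proof.
move=> S0 eS.
have gamma0 : 0 < gamma by exact: lt_trans gamma1.
have gp1 : 0 < gamma + 1 by rewrite addr_gt0.
have gm1 : 0 < gamma - 1 by rewrite subr_gt0.
pose q := 2 * gamma / (gamma + 1); pose q' := 2 * gamma / (gamma - 1).
have q0 : 0 < q by rewrite divr_gt0// mulr_gt0.
have q'0 : 0 < q' by rewrite divr_gt0// mulr_gt0.
have qq' : q^-1 + q'^-1 = 1.
  by rewrite /q /q'; field; rewrite !gt_eqF.
have qE : q^-1 = (gamma + 1) / (2 * gamma) by rewrite /q invf_div.
have mI : measurable (`[0, T]%classic : set (measurableTypeR R)) by [].
have mc := @measurable_cell R P.
have mm := measurable_momentum; have mf' := measurable_force.
have mg : measurable_fun (stcell P T) (EFin \o force_power).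
  by apply/measurable_EFinP; exact: measurable_funM.
rewrite -qE.
have -> : (\int[stvol]_(z in stcell P T) (force_power z)%:E =
    \int[leb]_(t in `[0%R, T]) (\int[vol]_(x in cell P) (force_power (t, x))%:E))%E.
  apply: (@tonelli_prod _ _ _ _ _ leb vol _ _ mI mc (EFin \o force_power) mg).
  by move=> z; rewrite lee_fin force_power_ge0.
rewrite /force_norm LtLx_norm1 -/q'.
have mLx : measurable_fun (`[0, T]%classic : set (measurableTypeR R))
    (fun t => Lx_norm P q'%:E (fun x => vnorm (f t x))).
  rewrite (_ : (fun t => _) = fun t => ((\int[vol]_(x in cell P)
      (`|vnorm (f t x)| `^ q')%:E) `^ q'^-1)%E); last first.
    by apply/funext => t; rewrite Lx_normE// gt_eqF.
  apply: (measurableT_comp (measurable_poweR _)).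
  apply: (@measurable_section_integral_ge0 _ _ _ _ _ vol _ _ mI mc
    (fun z => (`|vnorm (f z.1 z.2)| `^ q')%:E)).
    apply/measurable_EFinP; apply: (measurableT_comp (measurable_powR q')).
    exact: measurableT_comp.
  by move=> z; rewrite lee_fin powR_ge0.
rewrite -ge0_integralZl//; first last.
- by rewrite lee_fin powR_ge0.
- by move=> t _; exact: Lx_norm_ge0.
apply: ae_ge0_le_integral => //.
- by move=> t _; apply: integral_ge0 => x _; rewrite lee_fin force_power_ge0.
- apply: (@measurable_section_integral_ge0 _ _ _ _ _ vol _ _ mI mc (EFin \o force_power)) => //.
  by move=> z; rewrite lee_fin force_power_ge0.
- by move=> t _; rewrite mule_ge0 ?lee_fin ?powR_ge0// Lx_norm_ge0.
- exact: measurable_funeM.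
apply: (@filterS _ _ (ae_filter_ringOfSetsType _) _ _ _ eS) => t h tT; have [iE eSt] := h tT.
pose m x := Num.max (rho t x) 0 * vnorm (u t x).
have mmt : measurable_fun (cell P) m by exact: (measurable_slice mI mc mm tT).
have mft : measurable_fun (cell P) (fun x => vnorm (f t x)).
  exact: (measurable_slice mI mc mf' tT).
have m0 x : 0 <= m x by rewrite mulr_ge0 ?vnorm_ge0// le_max lexx orbT.
apply: (@le_trans _ _ (\int[vol]_(x in cell P) (`|m x * vnorm (f t x)|)%:E)%E).
  rewrite le_eqVlt; apply/orP; left; apply/eqP; apply: eq_integral => x _.
  by rewrite ger0_norm// mulr_ge0// vnorm_ge0.
apply: (le_trans (hoelder_cell mmt mft q0 q'0 qq')).
rewrite lee_wpmul2r ?Lx_norm_ge0// Lx_normE ?gt_eqF//.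
apply: (@le_trans _ _ (((energy_const kappa gamma * S)%:E) `^ q^-1)%E); last by rewrite poweR_EFin.
have m1 : measurable_fun (cell P) (fun x => `|m x| `^ q).
  by apply: (measurableT_comp (measurable_powR q)); exact: measurableT_comp.
have ec0 := energy_const_gt0 kappa0 gamma1.
have iE' : vol.-integrable (cell P) (EFin \o (fun x =>
    energy_const kappa gamma * energy kappa gamma (rho t x) (u t x))).
  by apply: (@integrableZl _ _ _ vol _ mc _
    (EFin \o (fun x => energy kappa gamma (rho t x) (u t x)))).
have I1 : (\int[vol]_(x in cell P) (`|m x| `^ q)%:E <= (energy_const kappa gamma * S)%:E)%E.
  apply: (@le_trans _ _ (\int[vol]_(x in cell P)
      (energy_const kappa gamma * energy kappa gamma (rho t x) (u t x))%:E)%E).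
    apply: ge0_le_integral => //.
    - exact/measurable_EFinP.
    - exact: measurable_int iE'.
    - by move=> x _; rewrite lee_fin ger0_norm//; exact: momentum_powR_le.
  rewrite -[leLHS]fineK; last exact: (@integrable_fin_num _ _ _ vol _ mc _ iE').
  rewrite lee_fin -[leLHS]/(Rintegral _ _ _) RintegralZl//.
  by rewrite ler_wpM2l// ltW.
have cS0 : 0 <= energy_const kappa gamma * S by rewrite mulr_ge0// ltW.
apply: gt0_ler_poweR I1.
- by rewrite invr_ge0 ltW.
- rewrite in_itv/= leey andbT; apply: integral_ge0 => x _; rewrite lee_fin; exact: powR_ge0.
- by rewrite in_itv/= leey andbT lee_fin.
Qed.

End work_of_the_force.

(** * The uniform energy bound *)

Section energy_bound.
Context {R : realType}.
Variables (P T kappa gamma mu lambda : R).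
Hypotheses (P0 : 0 < P) (T0 : 0 < T) (kappa0 : 0 < kappa) (gamma1 : 1 < gamma).
Hypotheses (mu0 : 0 <= mu) (lm0 : 0 <= lambda + mu).
Variables (rho0 : E3 R -> R) (u0 : E3 R -> 'rV[R]_3).
Variables (rho : R -> E3 R -> R) (u f : R -> E3 R -> 'rV[R]_3)
  (Du : R -> E3 R -> 'M[R]_3).
Hypothesis data : admissible_data P kappa gamma rho0 u0 f.
Hypotheses (mrho : measurable_fun forward (uncurry rho))
  (mu_ : forall i, measurable_fun forward (uncurry (fun t x => u t x 0 i))).
Hypotheses (prho : forall t, 0 <= t -> Defs.periodic P (rho t) /\ Defs.periodic P (u t))
  (pDu : forall t, 0 <= t -> Defs.periodic P (Du t)).
Hypothesis rho_ge0 : {ae stvol, forall z, forward z -> 0 <= rho z.1 z.2}.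
Hypothesis en : energy_inequality kappa gamma T mu lambda rho0 u0 f rho u Du.

Let E t x := energy kappa gamma (rho t x) (u t x).
Let s t x := vdot (rho t x *: u t x) (f t x)
  - mu * mxnorm (Du t x) ^+ 2 - (lambda + mu) * (\tr (Du t x)) ^+ 2.
Let a0 x := energy kappa gamma (rho0 x) (u0 x).
Let E0 := fine (initial_energy P kappa gamma rho0 u0).
Let F0 := fine (force_norm P gamma T f).
Let e t := \int[vol]_(x in cell P) E t x.

Definition energy_exponent : R := (gamma + 1) / (2 * gamma).

(** The bound given by [sublinear_bound]. *)
Definition energy_cap (E F : R) : R :=
  1 + (E + energy_const kappa gamma `^ energy_exponent * F)
      `^ (1 - energy_exponent)^-1.

Let mI : measurable (`[0, T]%classic : set (measurableTypeR R)). Proof. by []. Qed.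
Let mc := @measurable_cell R P.

Let pf t : 0 <= t -> Defs.periodic P (f t).
Proof. by case: data => [[+ _ _] _ _ _ _]; apply. Qed.

Let initial_energyE : \int[vol]_(x in cell P) a0 x = E0.
Proof.
have [_ [_ _ mrho0 mu0_] [_ ae0] _ _] := data.
rewrite /Rintegral /E0 /initial_energy; congr fine.
have ma0 : measurable_fun (cell P) a0.
  by case: en => -[_ _ _ la0] _; apply: measurable_funTS; exact: measurable_loc.
apply: ae_eq_integral => //.
- exact/measurable_EFinP.
- apply/measurable_EFinP; apply: measurable_funTS; apply: measurable_funD.
    apply: measurable_funM; first by apply: measurable_funM.
    apply: measurable_funX; exact: measurable_vnorm.
  apply: measurable_funM => //; rewrite /pressure; apply: measurable_funM => //.
  exact: (measurableT_comp (measurable_powR gamma)).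
- apply: (@filterS _ _ (ae_filter_ringOfSetsType _) _ _ _ ae0) => x h Px.
  have r0 := h Px; congr EFin; rewrite /a0 energyE//.
  have -> : Num.max (rho0 x) 0 = rho0 x by apply/max_idPl.
  by rewrite /pressure mulrA [(gamma - 1)^-1 * _]mulrC.
Qed.

Let s_le t x : 0 <= rho t x -> s t x <= force_power rho u f (t, x).
Proof.
move=> r0; apply: (@le_trans _ _ (vdot (rho t x *: u t x) (f t x))).
  have h1 : 0 <= mu * mxnorm (Du t x) ^+ 2 by rewrite mulr_ge0 ?sqr_ge0.
  have h2 : 0 <= (lambda + mu) * (\tr (Du t x)) ^+ 2 by rewrite mulr_ge0 ?sqr_ge0.
  by rewrite /s; move: h1 h2; lra.
apply: (le_trans (vdot_le _ _)); rewrite vnormZ// /force_power /=.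
by have -> : Num.max (rho t x) 0 = rho t x by apply/max_idPl.
Qed.

(** The weak inequality first gives a finite bound [W + E0] that depends on the
    solution.  Inserting this bound into the estimate of the work of the force
    gives a sublinear inequality for it, in which only the data remain. *)
Lemma energy_bound :
  {ae leb, forall t, `[0, T]%classic t ->
    vol.-integrable (cell P) (EFin \o (fun x => energy kappa gamma (rho t x) (u t x))) /\
    \int[vol]_(x in cell P) energy kappa gamma (rho t x) (u t x)
      <= energy_cap E0 F0}.
Proof.
have gamma0 : 0 < gamma by exact: lt_trans gamma1.
have [[_ mf ff] [_ pu0 _ _] _ _ E0y] := data.
have pr0 : Defs.periodic P rho0 by case: data => _ [].
have F0E : force_norm P gamma T f = F0%:E.
  by rewrite /F0 fineK// ge0_fin_numE ?ff//; exact: Lnorm_ge0.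
have F00 : 0 <= F0 by rewrite fine_ge0//; exact: Lnorm_ge0.
have E_ge0 t x : 0 <= E t x by exact: energy_ge0.
have E00 : 0 <= E0.
  by rewrite -initial_energyE; apply: Rintegral_ge0 => x _; exact: energy_ge0.
have [[lE lF ls la0] _] := en.
have iE := lE _ (@compact_stcell R P T) (@stcell_forward R P T); rewrite uncurryE in iE.
have is_ := ls _ (@compact_stcell R P T) (@stcell_forward R P T); rewrite uncurryE in is_.
have [aeE ie eE] := @fubini_prod _ _ _ _ _ leb vol _ _ mI mc (fun z => E z.1 z.2) iE.
have mst := @measurable_stcell R P T.
pose smax z := Num.max (s z.1 z.2) 0.
have ismax : stvol.-integrable (stcell P T) (EFin \o smax).
  apply: (@le_integrable _ _ _ stvol _ mst _ (EFin \o (fun z => s z.1 z.2))) => //.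
    apply/measurable_EFinP; apply: measurable_maxr => //.
    by apply/measurable_EFinP; exact: measurable_int is_.
  move=> z _; rewrite lee_fin ger0_norm ?le_max ?lexx ?orbT//.
  by rewrite ge_max ler_norm normr_ge0.
pose W := \int[stvol]_(z in stcell P T) smax z.
have W0 : 0 <= W by apply: Rintegral_ge0 => z _; rewrite le_max lexx orbT.
(* The source is bounded above by its positive part for every cutoff in time. *)
have e_le : {ae leb, forall t, `[0, T]%classic t -> e t <= W + E0}.
  apply: ae_le_of_ramp => // a d a_ge0 d0 adT.
  have pE t : 0 <= t -> Defs.periodic P (E t).
    by move=> t0 x j; have [p1 p2] := prho t0; rewrite /E p1 p2.
  have ps t : 0 <= t -> Defs.periodic P (s t).
    by move=> t0 x j; have [p1 p2] := prho t0; rewrite /s p1 p2 (pDu t0) (pf t0).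
  have pa0 : Defs.periodic P a0 by move=> x j; rewrite /a0 pr0 pu0.
  have pF t : 0 <= t -> Defs.periodic P (fun x => (energy kappa gamma (rho t x) (u t x)
      + pressure kappa gamma (rho t x)) *: u t x
      - u t x *m (stress mu lambda (Du t x))^T).
    by move=> t0 x j; have [p1 p2] := prho t0; rewrite p1 p2 (pDu t0).
  have := balance_test P0 pE ps pF pa0 en a_ge0 d0 adT.
  have mt : measurable_fun setT (fun z : measurableTypeR R *
    (measurableTypeR R * measurableTypeR R * measurableTypeR R) => z.1 : R).
    exact: measurable_fst.
  have -> : \int[stvol]_(z in stcell P T) (E z.1 z.2 * 'D_1 (ramp a d) z.1) =
      \int[leb]_(t in `[0, T]) (e t * 'D_1 (ramp a d) t).
    have bD := bounded_measurable_derive_ramp a d.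
    have iED : stvol.-integrable (stcell P T)
        (EFin \o (fun z => E z.1 z.2 * 'D_1 (ramp a d) z.1)).
      by apply: integrable_mul_bounded => //; exact: (bounded_measurable_comp mt bD).
    have [_ iED1 ->] := @fubini_prod _ _ _ _ _ leb vol _ _ mI mc
      (fun z => E z.1 z.2 * 'D_1 (ramp a d) z.1) iED.
    have ieD := @integrable_mul_bounded _ _ _ leb _ _ _ mI bD ie.
    rewrite /Rintegral; congr fine; apply: ae_eq_integral => //.
    - exact: measurable_int iED1.
    - exact: measurable_int ieD.
    - apply: (@filterS _ _ (ae_filter_ringOfSetsType _) _ _ _ aeE) => t h tT.
      by congr EFin; rewrite -RintegralZr//; exact: h.
  move=> /le_trans; apply; rewrite -initial_energyE lerD2r.
  apply: le_Rintegral => //.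
    apply: integrable_mul_bounded => //.
    exact: (bounded_measurableB (bounded_measurable_cst _ 1) (bounded_measurable_comp mt (bounded_measurable_ramp a d))).
  move=> z _; have /andP[r0 r1] := ramp_itv a d z.1.
  have : 0 <= 1 - ramp a d z.1 <= 1 by lra.
  rewrite /smax; have [s0|s0] := leP (s z.1 z.2) 0 => /andP[h1 h2].
    by rewrite mulr_le0_ge0.
  by rewrite ler_piMr// ltW.
have W_le S : 0 <= S -> {ae leb, forall t, `[0, T]%classic t -> e t <= S} ->
    W <= (energy_const kappa gamma * S) `^ energy_exponent * F0.
  move=> S0 eS.
  have eS' : {ae leb, forall t, `[0, T]%classic t ->
      vol.-integrable (cell P) (EFin \o (fun x => energy kappa gamma (rho t x) (u t x))) /\
      \int[vol]_(x in cell P) energy kappa gamma (rho t x) (u t x) <= S}.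
    apply: (@filterS2 _ _ (ae_filter_ringOfSetsType _) _ _ _ _ aeE eS) => t h1 h2 tT.
    by split; [exact: h1|exact: h2].
  rewrite -lee_fin EFinM -F0E.
  apply: le_trans (force_power_le kappa0 gamma1 mrho mu_ mf S0 eS').
  rewrite /W /Rintegral fineK; last exact: (@integrable_fin_num _ _ _ stvol _ mst _ ismax).
  apply: ae_ge0_le_integral => //.
  - by move=> z _; rewrite lee_fin le_max lexx orbT.
  - exact: measurable_int ismax.
  - by move=> z _; rewrite lee_fin force_power_ge0.
  - apply/measurable_EFinP; apply: measurable_funM.
      exact: measurable_momentum.
    exact: measurable_force.
  apply: (@filterS _ _ (ae_filter_ringOfSetsType _) _ _ _ rho_ge0) => z h zT.
  rewrite lee_fin ge_max force_power_ge0 andbT.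
  by case: z h zT => t x h zT; apply: s_le; exact: (h (stcell_forward zT)).
have S0 : 0 <= W + E0 by rewrite addr_ge0.
(* [W + E0] is itself an admissible [S] in [W_le]. *)
have cap : W + E0 <= energy_cap E0 F0.
  have ec0 := ltW (energy_const_gt0 kappa0 gamma1).
  apply: sublinear_bound => //.
  - by rewrite mulr_ge0// powR_ge0.
  - rewrite /energy_exponent divr_gt0 ?addr_gt0 ?mulr_gt0//=.
    by rewrite ltr_pdivrMr ?mulr_gt0// mul1r mulr_natl mulr2n ltrD2l.
  - rewrite addrC lerD2l; apply: le_trans (W_le _ S0 e_le) _.
    by rewrite (powRM _ ec0 S0) [leLHS]mulrAC [E0 + W]addrC.
apply: (@filterS2 _ _ (ae_filter_ringOfSetsType _) _ _ _ _ aeE e_le) => t h1 h2 tT.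
by split; [exact: h1|apply: le_trans cap; exact: h2].
Qed.

End energy_bound.

(** * Fourier coefficients of the state *)

Section coefficients.
Context {R : realType}.
Variables (P T kappa gamma : R).
Hypotheses (P0 : 0 < P) (kappa0 : 0 < kappa) (gamma1 : 1 < gamma).

Let V : R := fine (vol (cell P)).
Let mc := @measurable_cell R P.
Let mI : measurable (`[0, T]%classic : set (measurableTypeR R)). Proof. by []. Qed.

Lemma vol_cell_lty : (@vol R (cell P) < +oo)%E.
Proof.
have I0 : (@leb R `[(- (P / 2))%R, (P / 2)%R]%classic < +oo)%E.
  by rewrite [X in (X < _)%E]lebesgue_measure_itv/=; case: ifP => // _; rewrite -EFinB ltry.
rewrite cellE -[X in (X < _)%E]/((@leb2 R \x leb)%E _) product_measure1E//; last first.
  exact: measurableX.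
rewrite lte_mul_pinfty// ge0_fin_numE//.
  by rewrite -[X in (X < _)%E]/((leb \x leb)%E _) product_measure1E// lte_mul_pinfty// ge0_fin_numE.
Qed.

(** From [|h| <= (1 + h^2) / 2], which also gives the integrability of [h]. *)
Lemma cell_integral_le (h E : E3 R -> R) (c : R) :
  measurable_fun (cell P) h -> vol.-integrable (cell P) (EFin \o E) ->
  (forall x, h x ^+ 2 <= c * E x) ->
  `|\int[vol]_(x in cell P) h x| <= 2^-1 * (V + c * \int[vol]_(x in cell P) E x).
Proof.
move=> mh iE hE.
have i1 : vol.-integrable (cell P) (EFin \o (fun=> 1 : R)).
  by apply: bounded_integrable => //; [exact: vol_cell_lty|exact: bounded_measurable_cst].
have icE : vol.-integrable (cell P) (EFin \o (fun x => c * E x)).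
  by apply: (@integrableZl _ _ _ vol _ mc c (EFin \o E)).
have iN : vol.-integrable (cell P) (EFin \o (fun x => 1 + c * E x)).
  by have := @integrableD _ _ _ vol _ mc _ _ i1 icE.
have iN' : vol.-integrable (cell P) (EFin \o (fun x => 2^-1 * (1 + c * E x))).
  by apply: (@integrableZl _ _ _ vol _ mc 2^-1 (EFin \o (fun x => 1 + c * E x))).
have hN x : `|h x| <= 2^-1 * (1 + c * E x).
  have := hE x; rewrite -(real_normK (num_real (h x))) => h2.
  have := sqr_ge0 (`|h x| - 1).
  by rewrite sqrrB expr1n mulr1; lra.
have ih : vol.-integrable (cell P) (EFin \o h).
  apply: (@le_integrable _ _ _ vol _ mc _ (EFin \o (fun x => 2^-1 * (1 + c * E x)))) => //.
    exact/measurable_EFinP.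
  by move=> x _ /=; rewrite lee_fin (le_trans (hN x))// ler_norm.
apply: (le_trans (@le_normr_Rintegral _ _ _ vol _ _ mc ih)).
apply: (@le_trans _ _ (\int[vol]_(x in cell P) (2^-1 * (1 + c * E x)))).
  apply: le_Rintegral => //.
  by apply: (@integrable_norm _ _ _ vol).
rewrite RintegralZl// RintegralD// RintegralZl// ler_wpM2l// lerD2r.
by rewrite Rintegral_cst// mul1r.
Qed.

Lemma fourier_sqE n (g : E3 R -> 'rV[R]_n) k : fourier_sq P g k =
  \sum_(i < n) ((V^-1 * \int[vol]_(x in cell P) (g x 0 i * cos (phase P k x))) ^+ 2 +
    (V^-1 * \int[vol]_(x in cell P) (g x 0 i * sin (phase P k x))) ^+ 2).
Proof.
apply: eq_bigr => i _; rewrite /fourier /= sqr_sqrtr ?sqrrN//.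
by rewrite addr_ge0// sqr_ge0.
Qed.

Lemma fourier_sq_ge0 n (g : E3 R -> 'rV[R]_n) k : 0 <= fourier_sq P g k.
Proof. by apply: sumr_ge0 => i _; rewrite sqr_ge0. Qed.

Lemma measurable_phase k : measurable_fun setT (phase P k).
Proof.
apply: measurable_sum => j; apply: measurable_funM => //.
case: j => -[|[|[|//]]] i; rewrite /xcoord /=.
- exact: measurable_x1.
- exact: measurable_x2.
- exact: measurable_x3.
Qed.

Lemma measurable_cosphase k : measurable_fun setT (cos \o phase P k).
Proof.
apply: measurableT_comp; last exact: measurable_phase.
by apply: continuous_measurable_fun; exact: continuous_cos.
Qed.

Lemma measurable_sinphase k : measurable_fun setT (sin \o phase P k).
Proof.
apply: measurableT_comp; last exact: measurable_phase.
by apply: continuous_measurable_fun; exact: continuous_sin.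
Qed.

Lemma measurable_state (rho : R -> E3 R -> R) (u : R -> E3 R -> 'rV[R]_3) i :
  measurable_fun forward (uncurry rho) ->
  (forall i, measurable_fun forward (uncurry (fun t x => u t x 0 i))) ->
  measurable_fun (stcell P T)
    (fun z => state kappa gamma (rho z.1 z.2) (u z.1 z.2) 0 i).
Proof.
move=> mrho mu_.
have ms : measurable_fun setT (@Num.sqrt R).
  by apply: continuous_measurable_fun; exact: sqrt_continuous.
have mr : measurable_fun (stcell P T) (fun z => rho z.1 z.2).
  by have := @measurable_stcell_forward R P T _ _ _ mrho; rewrite uncurryE.
rewrite /state; case: (split_ordP i) => j ->.
  under eq_fun do rewrite row_mxEl mxE.
  apply: measurable_funM; first exact: measurableT_comp.
  by have := @measurable_stcell_forward R P T _ _ _ (mu_ j); rewrite uncurryE.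
rewrite [j]ord1; under eq_fun do rewrite row_mxEr mxE eqxx mulr1n sqrt_sound//.
apply: measurableT_comp => //; apply: measurable_funM => //.
apply: (measurableT_comp (measurable_powR gamma)).
exact: measurable_maxr.
Qed.

Variables (rho : R -> E3 R -> R) (u : R -> E3 R -> 'rV[R]_3).
Hypotheses (mrho : measurable_fun forward (uncurry rho))
  (mu_ : forall i, measurable_fun forward (uncurry (fun t x => u t x 0 i))).
Let st t x := state kappa gamma (rho t x) (u t x).

Lemma measurable_fourier_sq k :
  measurable_fun (`[0, T]%classic : set (measurableTypeR R)) (fun t => fourier_sq P (st t) k).
Proof.
rewrite (_ : (fun t => _) = fun t => \sum_(i < 3 + 1)
  ((V^-1 * \int[vol]_(x in cell P) (st t x 0 i * cos (phase P k x))) ^+ 2 +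
   (V^-1 * \int[vol]_(x in cell P) (st t x 0 i * sin (phase P k x))) ^+ 2)); last first.
  by apply/funext => t; exact: fourier_sqE.
have mtrig (w : E3 R -> R) i : measurable_fun setT w ->
    measurable_fun (`[0, T]%classic : set (measurableTypeR R))
      (fun t => \int[vol]_(x in cell P) (st t x 0 i * w x)).
  move=> mw.
  apply: (@measurable_section_Rintegral _ _ _ _ _ vol _ _ mI mc
    (fun z => st z.1 z.2 0 i * w z.2)).
  apply: measurable_funM; first exact: measurable_state.
  by apply: measurable_funTS; exact: measurableT_comp.
apply: measurable_sum => i; apply: measurable_funD; apply: measurable_funX;
  apply: measurable_funM => //; apply: mtrig.
- exact: measurable_cosphase.
- exact: measurable_sinphase.
Qed.

(** Four components with a real and an imaginary part each; the inner factor is that of [cell_integral_le]. *)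
Definition coefficient_cap (cap : R) : R :=
  8 * (V^-1 * (2^-1 * (V + (gamma + 1) * cap))) ^+ 2.

Lemma fourier_sq_le cap t k : `[0, T]%classic t ->
  vol.-integrable (cell P) (EFin \o (fun x => energy kappa gamma (rho t x) (u t x))) ->
  \int[vol]_(x in cell P) energy kappa gamma (rho t x) (u t x) <= cap ->
  fourier_sq P (st t) k <= coefficient_cap cap.
Proof.
move=> tT iE ecap; rewrite fourier_sqE.
have V0 : 0 <= V^-1 by rewrite invr_ge0 fine_ge0.
have g1 : 0 <= gamma + 1 by rewrite addr_ge0// ltW// (lt_trans ltr01).
set N := 2^-1 * (V + (gamma + 1) * cap).
have bound (w : E3 R -> R) i : measurable_fun setT w -> (forall x, w x ^+ 2 <= 1) ->
    (V^-1 * \int[vol]_(x in cell P) (st t x 0 i * w x)) ^+ 2 <= (V^-1 * N) ^+ 2.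
  move=> mw w1; rewrite -[leLHS](real_normK (num_real _)).
  have h : `|\int[vol]_(x in cell P) (st t x 0 i * w x)| <= N.
    apply: (@le_trans _ _ (2^-1 * (V + (gamma + 1) *
        \int[vol]_(x in cell P) energy kappa gamma (rho t x) (u t x)))).
      apply: cell_integral_le => //.
        apply: measurable_funM; last exact: measurable_funTS.
        exact: (measurable_slice mI mc (measurable_state i mrho mu_) tT).
      move=> x; rewrite exprMn; apply: le_trans (state_sq_le _ gamma1 _ _ i).
      by rewrite ler_piMr ?sqr_ge0.
    by rewrite /N ler_wpM2l// lerD2l ler_wpM2l.
  have N0 : 0 <= N by exact: le_trans h.
  have VN0 : 0 <= V^-1 * N by rewrite mulr_ge0.
  apply: lerXn2r; rewrite ?nnegrE//.
  by rewrite normrM (ger0_norm V0) ler_wpM2l.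
apply: (@le_trans _ _ (\sum_(i < 3 + 1) ((V^-1 * N) ^+ 2 + (V^-1 * N) ^+ 2))).
  apply: ler_sum => i _; apply: lerD; apply: bound.
  - exact: measurable_cosphase.
  - by move=> x; rewrite -(cos2Dsin2 (phase P k x)) lerDl sqr_ge0.
  - exact: measurable_sinphase.
  - by move=> x; rewrite -(cos2Dsin2 (phase P k x)) lerDr sqr_ge0.
rewrite sumr_const card_ord /coefficient_cap -/N.
by rewrite -[(3 + 1)%N]/4%N le_eqVlt; apply/orP; left; apply/eqP; ring.
Qed.

End coefficients.

(** * Spectral decay and the Sobolev bound *)

Section spectral_decay.
Context {R : realType}.
Implicit Types (beta C D K kstar r : R).

Definition spectral_const beta C D kstar : R :=
  D * (1 + kstar ^+ 2) `^ ((3 + beta) / 2)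
  + C * (1 + kstar ^- 2) `^ ((3 + beta) / 2).

Lemma spectral_const_ge0 beta C D kstar : 0 <= C -> 0 <= D ->
  0 <= spectral_const beta C D kstar.
Proof. by move=> C0 D0; rewrite addr_ge0// mulr_ge0// powR_ge0. Qed.

(** The low frequencies are bounded by a constant, the high ones decay; on both
    ranges the two bounds are comparable with one power of [1 + K^2]. *)
Lemma spectral_decay beta C D kstar K r : 0 < beta -> 0 < C -> 0 < kstar ->
  0 <= K -> 0 <= D -> r <= D -> (kstar <= K -> K `^ (3 + beta) * r <= C) ->
  r <= spectral_const beta C D kstar * (1 + K ^+ 2) `^ (- ((3 + beta) / 2)).
Proof.
move=> b0 C0 k0 K0 D0 rD rC; set p := (3 + beta) / 2.
have p0 : 0 <= p by rewrite divr_ge0// addr_ge0// ltW.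
have x0 : 0 < 1 + K ^+ 2 by rewrite ltr_wpDr ?sqr_ge0.
rewrite powRN ler_pdivlMr ?powR_gt0// /spectral_const -/p.
have [kK|Kk] := leP kstar K.
  have Kp : 0 < K by exact: lt_le_trans kK.
  have Kpos : 0 < K `^ (3 + beta) by exact: powR_gt0.
  have h1 : (1 + K ^+ 2) `^ p <= (1 + kstar ^- 2) `^ p * K `^ (3 + beta).
    have -> : K `^ (3 + beta) = (K ^+ 2) `^ p.
      by rewrite -(powR_mulrn 2 K0) -powRrM; congr (_ `^ _); rewrite /p; field.
    have k2 : 0 <= 1 + kstar ^- 2 by rewrite addr_ge0// invr_ge0 sqr_ge0.
    rewrite -powRM ?sqr_ge0//; apply: ge0_ler_powR => //; rewrite ?nnegrE ?(ltW x0)//.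
      by rewrite mulr_ge0// sqr_ge0.
    rewrite mulrDl mul1r addrC lerD2l mulrC ler_pdivlMr ?exprn_gt0// mul1r.
    by rewrite ler_sqr ?nnegrE// ltW.
  have C0' : 0 <= (1 + kstar ^- 2) `^ p by exact: powR_ge0.
  have [r0|r0] := leP r 0.
    apply: (@le_trans _ _ 0); first by rewrite mulr_le0_ge0// powR_ge0.
    by rewrite addr_ge0// mulr_ge0 ?powR_ge0// ltW.
  apply: (@le_trans _ _ (C * (1 + kstar ^- 2) `^ p)); last first.
    by rewrite lerDr mulr_ge0// powR_ge0.
  apply: (@le_trans _ _ (r * ((1 + kstar ^- 2) `^ p * K `^ (3 + beta)))).
    by rewrite ler_wpM2l// ltW.
  rewrite mulrCA [C * _]mulrC ler_wpM2l// mulrC; exact: rC.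
apply: (@le_trans _ _ (D * (1 + kstar ^+ 2) `^ p)).
  apply: (@le_trans _ _ (D * (1 + K ^+ 2) `^ p)).
    by rewrite ler_wpM2r// powR_ge0.
  rewrite ler_wpM2l//; apply: ge0_ler_powR => //; rewrite ?nnegrE ?addr_ge0 ?sqr_ge0//.
  by rewrite lerD2l ler_sqr ?nnegrE// ltW.
by rewrite lerDl mulr_ge0 ?powR_ge0// ltW.
Qed.

End spectral_decay.

Section conclusion.
Context {R : realType}.
Variables (P kappa gamma : R).
Hypotheses (P0 : 0 < P) (kappa0 : 0 < kappa) (gamma1 : 1 < gamma).

Definition time_coefficient_cap (T E F : R) : R :=
  T * coefficient_cap P gamma (energy_cap kappa gamma E F).

Definition lattice_sum (s : R) : R :=
  fine (\esum_(k in [set: 'rV[int]_3])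
    ((1 + vnorm (freq P k) ^+ 2) `^ (- s))%:E)%E.

Definition sobolev_cap (T alpha E F C kstar beta : R) : R :=
  1 + (spectral_const beta C (time_coefficient_cap T E F) kstar
       * lattice_sum ((3 + beta) / 2 - alpha)) `^ 2^-1.

(** Sum and integral are exchanged by [integral_esum], and the powers of the
    frequency are added. *)
Lemma L2H_norm_le (T alpha Q s : R) (rho : R -> E3 R -> R) (u : R -> E3 R -> 'rV[R]_3) :
  measurable_fun forward (uncurry rho) ->
  (forall i, measurable_fun forward (uncurry (fun t x => u t x 0 i))) ->
  0 <= Q -> 3 / 2 < s - alpha ->
  (forall k, (\int[leb]_(t in `[0%R, T])
      (fourier_sq P (fun x => state kappa gamma (rho t x) (u t x)) k)%:E
      <= (Q * (1 + vnorm (freq P k) ^+ 2) `^ (- s))%:E)%E) ->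
  (L2H_norm P T alpha (fun t x => state kappa gamma (rho t x) (u t x))
    <= ((Q * lattice_sum (s - alpha)) `^ 2^-1)%:E)%E.
Proof.
move=> mrho mu_ Q0 sa hk.
pose st t x := state kappa gamma (rho t x) (u t x).
have mI : measurable (`[0, T]%classic : set (measurableTypeR R)) by [].
pose w k : R := 1 + vnorm (freq P k) ^+ 2.
have w0 k : 0 < w k by rewrite ltr_wpDr ?sqr_ge0.
pose a k t : \bar R := ((w k) `^ alpha * fourier_sq P (st t) k)%:E.
have a0 k t : (0 <= a k t)%E by rewrite lee_fin mulr_ge0 ?powR_ge0 ?fourier_sq_ge0.
have Z := esum_freq_lty P0 sa.
have ZE : (\esum_(k in [set: 'rV[int]_3]) ((w k) `^ (- (s - alpha)))%:E =
    (lattice_sum (s - alpha))%:E)%E.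
  rewrite /lattice_sum fineK// ge0_fin_numE//; apply: esum_ge0 => k _.
  by rewrite lee_fin powR_ge0.
have L0 : 0 <= lattice_sum (s - alpha).
  by apply: fine_ge0; apply: esum_ge0 => k _; rewrite lee_fin powR_ge0.
rewrite -poweR_EFin /L2H_norm unlock.
apply: gt0_ler_poweR.
- by rewrite invr_ge0.
- by rewrite in_itv/= leey andbT; apply: integral_ge0 => t _; exact: poweR_ge0.
- by rewrite in_itv/= leey andbT lee_fin mulr_ge0.
rewrite [leLHS](_ : _ = (\int[leb]_(t in `[0%R, T]) \esum_(k in [set: 'rV[int]_3]) a k t)%E); last first.
  rewrite [RHS]integral_mkcond; apply: eq_integral => t _; rewrite !patchE.
  case: ifP => _; last by rewrite /= normr0 powR0.
  rewrite /sobolev_norm gee0_abs ?poweR_ge0// -poweRrM mulVf// poweRe1//.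
  by apply: esum_ge0 => k _; exact: a0.
rewrite integral_esum//; last first.
  move=> k; apply/measurable_EFinP; apply: measurable_funM => //.
  exact: measurable_fourier_sq.
apply: (@le_trans _ _ (\esum_(k in [set: 'rV[int]_3]) (Q%:E * ((w k) `^ (- (s - alpha)))%:E))%E).
  apply: le_esum => k _; rewrite /a.
  under eq_integral do rewrite EFinM.
  rewrite ge0_integralZl//; last 3 first.
  - by apply/measurable_EFinP; exact: measurable_fourier_sq.
  - by move=> t _; rewrite lee_fin fourier_sq_ge0.
  - by rewrite lee_fin powR_ge0.
  apply: le_trans (lee_wpmul2l _ (hk k)) _; first by rewrite lee_fin powR_ge0.
  rewrite -!EFinM lee_fin mulrCA -powRD; last first.
    by apply/implyP => _; rewrite gt_eqF.
  by rewrite opprB.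
apply: le_trans (esumZ_le _ Q0 _) _; first by move=> k; rewrite lee_fin powR_ge0.
by rewrite ZE -EFinM.
Qed.

End conclusion.

Theorem proposition3p1 (R : realType) (P kappa gamma : R)
    (P_gt0 : 0 < P) (kappa_gt0 : 0 < kappa) (gamma_gt1 : 1 < gamma) :
  exists M : R -> R -> R -> R -> R -> R -> R -> R,
  forall (mu0 : R) (lambda : R -> R) (mus : set R)
    (rho0 : E3 R -> R) (u0 : E3 R -> 'rV[R]_3)
    (f : R -> E3 R -> 'rV[R]_3)
    (rho : R -> R -> E3 R -> R) (u : R -> R -> E3 R -> 'rV[R]_3)
    (C kstar beta : R -> R),
  0 < mu0 ->
  (forall mu, mus mu -> admissible_viscosity mu0 mu (lambda mu)) ->
  lambda mu @[mu --> 0^'+] --> (0 : R) ->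
  admissible_data P kappa gamma rho0 u0 f ->
  (forall mu, mus mu ->
     weak_solution P kappa gamma mu (lambda mu) rho0 u0 f (rho mu) (u mu)) ->
  CKHw P kappa gamma mus rho u C kstar beta ->
  forall T alpha : R, 0 < T -> 0 < alpha < beta T / 2 ->
  let MT := M T alpha (fine (initial_energy P kappa gamma rho0 u0))
              (fine (force_norm P gamma T f)) (C T) (kstar T) (beta T) in
  0 < MT /\
  forall mu, mus mu ->
    (L2H_norm P T alpha
       (fun t x => state kappa gamma (rho mu t x) (u mu t x)) <= MT%:E)%E.
Proof.
exists (sobolev_cap P kappa gamma).
move=> mu0 lambda mus rho0 u0 f rho u C kstar beta _ visc _ data sol ckhw T alpha T0
  /andP[alpha0 alphab] MT.
split; first by rewrite /MT /sobolev_cap ltr_wpDr// powR_ge0.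
move=> mu musmu.
have [C0 k0 b0 hk] := ckhw T T0.
have [mu_gt0 _ lm] := visc mu musmu.
have [per [mrho mu_] rho_ge0 [Du [pDu _ hT]]] := sol mu musmu.
have [_ _ _ _ en] := hT T T0.
have lm0 : 0 <= lambda mu + mu by lra.
have eb := energy_bound P_gt0 T0 kappa_gt0 gamma_gt1 (ltW mu_gt0) lm0 data mrho mu_
  per pDu rho_ge0 en.
set E := fine (initial_energy _ _ _ _ _) in MT eb *.
set F := fine (force_norm _ _ _ _) in MT eb *.
have mI : measurable (`[0, T]%classic : set (measurableTypeR R)) by [].
pose D := coefficient_cap P gamma (energy_cap kappa gamma E F).
have D0 : 0 <= D by rewrite /D /coefficient_cap mulr_ge0// sqr_ge0.
have low k : (\int[leb]_(t in `[0%R, T])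
    (fourier_sq P (fun x => state kappa gamma (rho mu t x) (u mu t x)) k)%:E
    <= (T * D)%:E)%E.
  apply: (@le_trans _ _ (\int[leb]_(t in `[0%R, T]) (cst D%:E t))%E).
    apply: ae_ge0_le_integral => //.
    - by move=> t _; rewrite lee_fin fourier_sq_ge0.
    - by apply/measurable_EFinP; exact: measurable_fourier_sq.
    apply: (@filterS _ _ (ae_filter_ringOfSetsType _) _ _ _ eb) => t h tT.
    have [iE eE] := h tT; rewrite lee_fin.
    exact: (fourier_sq_le gamma_gt1 mrho mu_ k tT iE eE).
  rewrite integral_cst// [X in (_ * X)%E](_ : _ = T%:E); last first.
    by rewrite [LHS]lebesgue_measure_itv/= lte_fin T0 sube0.
  by rewrite -EFinM mulrC.
apply: (@le_trans _ _ ((spectral_const (beta T) (C T) (T * D) (kstar T)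
       * lattice_sum P ((3 + beta T) / 2 - alpha)) `^ 2^-1)%:E).
  apply: L2H_norm_le => //.
  - by apply: spectral_const_ge0; [exact: ltW|rewrite mulr_ge0// ltW].
  - lra.
  move=> k; have := hk mu musmu k; have := low k.
  set I := (\int[leb]_(t in _) _)%E => IT IC.
  have I0 : (0 <= I)%E by apply: integral_ge0 => t _; rewrite lee_fin fourier_sq_ge0.
  have Ifin : I \is a fin_num by rewrite ge0_fin_numE// (le_lt_trans IT)// ltry.
  rewrite -(fineK Ifin) lee_fin; rewrite -(fineK Ifin) in IT IC.
  apply: spectral_decay => //.
  - exact: vnorm_ge0.
  - by rewrite mulr_ge0// ltW.
by rewrite /MT lee_fin /sobolev_cap /time_coefficient_cap -/D lerDr.
Qed.
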